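(* Let $\|\cdot\|$ be an arbitrary norm on $\mathbb{R}^2$. Then there exists an explicit constant $M_{\|\cdot\|}>0$ such that the following holds. Let $0\le\theta<2\pi$ and $\delta>0$. Let $(I_n)_{n=0}^\infty$ be a sequence of closed non-degenerate intervals with $I_n\subset[0,M_{\|\cdot\|}]$ for all $n$. Let $m\in\mathbb{N}$ and let $(z_n)_{n=1}^\infty$ be a sequence in $\{0,1,\dots,m-1\}$ of residues mod $m$ such that for all $n\ge 1$ $$z_n\in\{\,s z_{n-1}+i z_{n-2}\pm z_{n-3} \bmod m \;:\; i,s\in\mathbb{Z}\,\},$$ where $z_0=1$ and $z_{-1}=z_{-2}=0$. Then there exist continuum many $\vec v\in\mathbb{R}^2\setminus\mathbb{Q}^2$ with best approximations sequence $(q_n,\vec p_n)_{n=0}^\infty$ (with respect to $\|\cdot\|$) and long displacement vectors $\vec\beta_n(\vec v)=\sqrt{q_{n+1}}\,(q_n\vec v-\vec p_n)$ such that: (A) $\|\vec\beta_n(\vec v)\|\in I_n$ for all $n\ge 0$; (B) $\vec\beta_n(\vec v)\in\Omega(\theta,\delta)$ for all $n\ge0$, and any two consecutive displacement vectors $\vec\beta_n(\vec v),\vec\beta_{n+1}(\vec v)$ lie in opposite quadrants; (C) $q_n\equiv z_n \pmod m$ for all $n\ge1$. Furthermore, $\vec v$ is not badly approximable, $\{(q_{n-2},\vec p_{n-2}),(q_{n-1},\vec p_{n-1}),(q_n,\vec p_n)\}$ is a basis of the lattice $\mathbb{Z}^3$ for all $n\ge2$, and if $\|\cdot\|_@$ is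 a best ellipsoid norm for $\|\cdot\|$ with parameters $a,c,D$, then the constant is $$M_{\|\cdot\|}=\left(\frac{4ac}{4D^2-1}\right)^{1/4}.$$ In particular: (i) for the Euclidean norm, best ellipsoid parameters are $a=c=1$, $D=1$, and $M_{\|\cdot\|}=\sqrt{2/\sqrt3}$; (ii) for the maximum norm, best ellipsoid parameters are $a=c=\frac12$, $D=\sqrt2$, and $M_{\|\cdot\|}=7^{-1/4}$; (iii) for the $p$-norm with $2<p<\infty$, best ellipsoid parameters are $a=c=2^{\frac2p-1}$, $D=2^{\frac12-\frac1p}$, and $M_{\|\cdot\|}=8^{\frac1{2p}}\,(8-4^{1/p})^{-1/4}$; (iv) for the $p$-norm with $1\le p<2$, best ellipsoid parameters are $a=c=1$, $D=2^{\frac1p-\frac12}$, and $M_{\|\cdot\|}=\sqrt2\,(2^{1+\frac2p}-1)^{-1/4}$.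
   Context: For $\vec v\in\mathbb{R}^2\setminus\mathbb{Q}^2$ and a norm $\|\cdot\|$ on $\mathbb{R}^2$, put $\langle \vec v\rangle=\min\{\|\vec v-\vec p\|:\vec p\in\mathbb{Z}^2\}$. A best approximations sequence of $\vec v$ with respect to $\|\cdot\|$ is a sequence $(q_n,\vec p_n)_{n=0}^\infty\subset\mathbb{N}\times\mathbb{Z}^2$ such that $1=q_0<q_1<\dots$; $q_n=\min\{q\in\mathbb{N}:\langle q\vec v\rangle<\langle q_{n-1}\vec v\rangle\}$ for $n\ge1$; and $\|q_n\vec v-\vec p_n\|=\langle q_n\vec v\rangle$ for all $n$. (The $q_n$ are determined by $\vec v$; the $\vec p_n$ are unique for all but finitely many $n$, and the sequence is treated as if it were unique.) The $n$th long displacement vector is $\vec\beta_n(\vec v)=\sqrt{q_{n+1}}\,(q_n\vec v-\vec p_n)$. $\vec v$ is badly approximable if $\inf_{T\ge1} T^{1/2}\min_{1\le q\le T}\langle q\vec v\rangle>0$ (with $q$ ranging over natural numbers). $\Omega(\theta,\delta)=\{(r\cos\beta,r\sin\beta)\in\mathbb{R}^2: r\in\mathbb{R},\ \theta-\delta\le\beta\le\theta+\delta\}$. $\|\cdot\|_@$ is a best ellipsoid norm for $\|\cdot\|$ with parameters $a,c>0$, $D\ge1$ if for all $\vec u=(u_1,u_2)\in\mathbb{R}^2$ $$\|\vec u\|_@:=\sqrt{au_1^2+cu_2^2}\ \le\ \|\vec u\|\ \le\ D\sqrt{au_1^2+cu_2^2},$$ and the parameters maximise the value $\left(\frac{4ac}{4D^2-1}\right)^{1/4}$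 among all triples $(a,c,D)$, $a,c>0$, $D\ge1$, satisfying these inequalities. *)

(* Defs.v *)
From mathcomp Require Import all_boot all_order all_algebra.
From mathcomp Require Import all_classical all_reals all_analysis.

Set Implicit Arguments.
Unset Strict Implicit.
Unset Printing Implicit Defensive.
Import Order.TTheory GRing.Theory Num.Theory.
Local Open Scope classical_set_scope.
Local Open Scope ring_scope.

Section Norms.
Context {R : realType}.
Implicit Types (N : 'rV[R]_2 -> R) (u v w : 'rV[R]_2) (a c D p : R).

(* Nonnegativity and N 0 = 0 follow from these three axioms.  The norm is a
   plain function because 'rV[R]_2 already carries the sup norm `|_|. *)
Definition is_norm N : Prop :=
  [/\ forall u w, N (u + w) <= N u + N w,
      forall (k : R) u, N (k *: u) = `|k| * N u
    & forall u, N u = 0 -> u = 0].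

Definition euclidean_norm u : R := Num.sqrt (u 0 0 ^+ 2 + u 0 1 ^+ 2).

Definition maximum_norm u : R := Num.max `|u 0 0| `|u 0 1|.

Definition p_norm p u : R := (`|u 0 0| `^ p + `|u 0 1| `^ p) `^ p^-1.

Definition ellipsoid_norm a c u : R :=
  Num.sqrt (a * u 0 0 ^+ 2 + c * u 0 1 ^+ 2).

Definition ellipsoid_params N a c D : Prop :=
  [/\ 0 < a, 0 < c, 1 <= D
    & forall u, ellipsoid_norm a c u <= N u <= D * ellipsoid_norm a c u].

Definition ellipsoid_value a c D : R :=
  ((4 * a * c) / (4 * D ^+ 2 - 1)) `^ 4^-1.

Definition best_ellipsoid N a c D : Prop :=
  ellipsoid_params N a c D /\
  forall a' c' D', ellipsoid_params N a' c' D' ->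
    ellipsoid_value a' c' D' <= ellipsoid_value a c D.

End Norms.

Section BestApproximations.
Context {R : realType}.
Implicit Types (N : 'rV[R]_2 -> R) (u v w : 'rV[R]_2).

Definition rational_point v : Prop :=
  exists r : 'rV[rat]_2, v = map_mx ratr r.

Definition int_vec (p : 'rV[int]_2) : 'rV[R]_2 := map_mx intr p.

(* For a norm N the infimum is attained, since the lattice is discrete. *)
Definition lattice_dist N v : R := inf (range (fun p => N (v - int_vec p))).

Definition is_least (A : set nat) (k : nat) : Prop :=
  A k /\ forall j, A j -> (k <= j)%N.

Definition best_approximations N v (q : nat -> nat) (p : nat -> 'rV[int]_2) :
    Prop :=
  [/\ q 0%N = 1%N,
      forall n, (q n < q n.+1)%N,
      forall n, is_least
        [set k | (0 < k)%N /\
           lattice_dist N (k%:R *: v) < lattice_dist N ((q n)%:R *: v)]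
        (q n.+1)
    & forall n, N ((q n)%:R *: v - int_vec (p n)) =
                lattice_dist N ((q n)%:R *: v)].

Definition long_displacement v (q : nat -> nat) (p : nat -> 'rV[int]_2)
    (n : nat) : 'rV[R]_2 :=
  Num.sqrt (q n.+1)%:R *: ((q n)%:R *: v - int_vec (p n)).

(* The inner infimum is the minimum of a finite nonempty set. *)
Definition badly_approximable N v : Prop :=
  0 < inf [set Num.sqrt T *
               inf [set lattice_dist N (q%:R *: v)
                   | q in [set q : nat | (0 < q)%N /\ q%:R <= T]]
          | T in [set T : R | 1 <= T]].

Definition Omega (theta delta : R) : set 'rV[R]_2 :=
  [set u | exists r beta : R,
     [/\ theta - delta <= beta <= theta + delta,
         u 0 0 = r * cos beta & u 0 1 = r * sin beta]].

(* Open quadrants, indexed by which coordinates are negative. *)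
Definition quadrant (s t : bool) : set 'rV[R]_2 :=
  [set u | 0 < (-1) ^+ s * u 0 0 /\ 0 < (-1) ^+ t * u 0 1].

Definition opposite_quadrants u w : Prop :=
  exists s t : bool, quadrant s t u /\ quadrant (~~ s) (~~ t) w.

End BestApproximations.

Definition approx_vec (q : nat) (p : 'rV[int]_2) : 'rV[int]_3 :=
  row_mx (q%:Z)%:M p.

Definition lattice_basis (b0 b1 b2 : 'rV[int]_3) : Prop :=
  forall w : 'rV[int]_3, exists! k : int * int * int,
    w = k.1.1 *: b0 + k.1.2 *: b1 + k.2 *: b2.

(* The residues are integers indexed by integers, so that z (-1) and z (-2)
   make sense; the values below index -2 are irrelevant. *)
Definition residue_sequence (m : nat) (z : int -> int) : Prop :=
  [/\ z 0 = 1, z (-1) = 0, z (-2) = 0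
    & forall n : int, 1 <= n ->
        0 <= z n < m%:Z /\
        exists s i : int,
          (z n = s * z (n - 1) + i * z (n - 2) + z (n - 3) %[mod m%:Z])%Z \/
          (z n = s * z (n - 1) + i * z (n - 2) - z (n - 3) %[mod m%:Z])%Z].

(* Main.v *)
(** Write b_n = (q_n, p_n) and d_n = q_n v - p_n.  Each new triple is obtained
    from the three previous ones by b_{n+1} = s b_n + i b_{n-1} +- b_{n-2}; it
    keeps b_{n-1}, b_n, b_{n+1} a basis of Z^3, realises any prescribed residue,
    and v is the limit of p_n / q_n.  A large i > 0 forces d_n to be nearly a
    negative multiple of d_{n-1}, so all the d_n stay in one double cone and
    alternate between opposite quadrants.  Then s, of order i^2, tunes q_{n+1} so
    that sqrt(q_{n+1}) ||d_n|| lies in I_n.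

    The projection of Z^3 along b_{n+1} to the plane is a lattice of covolume
    1 / q_{n+1} containing d_n.  Changing s by about i hardly changes
    sqrt(q_{n+1}) ||d_n|| but shifts the rows of that lattice parallel to d_n by
    a full period, so the nearest row can be placed half-way between the
    multiples of d_n.  Its points then have squared ellipsoid norm about
    |d_n|^2 / 4 + a c / (q_{n+1} |d_n|)^2, which exceeds D^2 |d_n|^2 as soon as
    q_{n+1}^2 ||d_n||^4 < 4 a c / (4 D^2 - 1): hence the constant M, and d_n is
    the shortest vector.

    These conditions are strict at v = p_{n+1} / q_{n+1}, hence hold on a small
    box around it; nesting the boxes gives v.  Two choices of q_{n+1} at each
    step embed the binary sequences in the set of such v, as v determines the
    q_n, and letting q_{n+1} / q_n tend to infinity makes v not badly
    approximable. *)

Require Import Defs.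
From mathcomp Require Import all_boot all_order all_algebra.
From mathcomp Require Import all_classical all_reals all_analysis.
From mathcomp Require Import ring lra zify.

Set Implicit Arguments.
Unset Strict Implicit.
Unset Printing Implicit Defensive.
Import Order.TTheory GRing.Theory Num.Theory.
Import numFieldNormedType.Exports.
Local Open Scope classical_set_scope.
Local Open Scope card_scope.
Local Open Scope ring_scope.

(** * Norms on the plane and their comparison with the sup norm *)

Section NormFacts.
Context {R : realType}.
Implicit Types u w : 'rV[R]_2.

Lemma ord2_eq (j : 'I_2) : j = 0 \/ j = 1.
Proof. by case: j => [[|[|//]] ?]; [left|right]; apply: val_inj. Qed.

Lemma row2P u w : u 0 0 = w 0 0 -> u 0 1 = w 0 1 -> u = w.
Proof.
move=> h0 h1; apply/rowP => j; by case: (ord2_eq j) => ->.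
Qed.

Definition row2 (x y : R) : 'rV[R]_2 := \row_j (if j == 0 then x else y).

Lemma row20 x y : row2 x y 0 0 = x. Proof. by rewrite mxE. Qed.
Lemma row21 x y : row2 x y 0 1 = y. Proof. by rewrite mxE. Qed.

Lemma coord_le_norm u j : `|u 0 j| <= `|u|.
Proof.
rewrite {2}/Num.norm/= mx_normrE.
exact: (@le_bigmax _ _ _ _ (fun ij : 'I_1 * 'I_2 => `|u ij.1 ij.2|) (0, j)).
Qed.

Lemma norm_le_coord u (r : R) : `|u 0 0| <= r -> `|u 0 1| <= r -> `|u| <= r.
Proof.
move=> h0 h1; rewrite {1}/Num.norm/= mx_normrE; apply/bigmax_leP; split.
  exact: le_trans h0.
by move=> [i j] _ /=; rewrite (ord1 i); case: (ord2_eq j) => ->.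
Qed.

Variables (N : 'rV[R]_2 -> R) (hN : is_norm N).

Lemma normD u w : N (u + w) <= N u + N w. Proof. by case: hN. Qed.
Lemma normZ k u : N (k *: u) = `|k| * N u. Proof. by case: hN. Qed.
Lemma norm0_eq u : N u = 0 -> u = 0. Proof. by case: hN => _ _; apply. Qed.

Lemma norm0 : N 0 = 0. Proof. by rewrite -(scale0r 0) normZ normr0 mul0r. Qed.
Lemma normN u : N (- u) = N u.
Proof. by rewrite -scaleN1r normZ normrN1 mul1r. Qed.
Lemma normBC u w : N (u - w) = N (w - u). Proof. by rewrite -normN opprB. Qed.

Lemma norm_ge0 u : 0 <= N u.
Proof. by have := normD u (- u); rewrite subrr norm0 normN; lra. Qed.

Lemma norm_gt0 u : u != 0 -> 0 < N u.
Proof.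
by move=> u0; rewrite lt_def norm_ge0 andbT; apply: contra_neq u0; exact: norm0_eq.
Qed.

Lemma normB_ge u w : N u - N w <= N (u - w).
Proof. by have := normD (u - w) w; rewrite subrK; lra. Qed.

Lemma norm_dist u w : `|N u - N w| <= N (u - w).
Proof.
have := normB_ge u w; have := normB_ge w u; rewrite (normBC w) ler_norml; lra.
Qed.

Lemma norm_le_sup : exists2 K, 0 < K & forall u, N u <= K * `|u|.
Proof.
exists (N (row2 1 0) + N (row2 0 1) + 1).
  by have := norm_ge0 (row2 1 0); have := norm_ge0 (row2 0 1); lra.
move=> u; have -> : u = u 0 0 *: row2 1 0 + u 0 1 *: row2 0 1.
  by apply: row2P; rewrite !mxE/=; ring.
set e := _ + _; have e0 : e 0 0 = u 0 0 by rewrite !mxE/=; ring.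
have e1 : e 0 1 = u 0 1 by rewrite !mxE/=; ring.
apply: le_trans (normD _ _) _; rewrite !normZ.
have := coord_le_norm e 0; have := coord_le_norm e 1; rewrite e0 e1.
have := norm_ge0 (row2 1 0); have := norm_ge0 (row2 0 1).
have := normr_ge0 (u 0 0); have := normr_ge0 (u 0 1).
nra.
Qed.

Lemma is_norm_continuous : continuous N.
Proof.
have [K K0 NK] := norm_le_sup.
move=> u; apply/(@cvgrPdist_lt _ R^o _ (nbhs u) (nbhs_filter u)) => e e0; apply/nbhs_ballP.
exists (e / K) => [|w]; first exact: divr_gt0.
rewrite -ball_normE/= => uw.
apply: le_lt_trans (norm_dist _ _) _; apply: le_lt_trans (NK _) _.
by rewrite mulrC -ltr_pdivlMr.
Qed.

(** [N] attains its minimum on the unit sphere of the sup norm, which is compact; the minimum is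
    positive, and homogeneity extends the bound to all vectors. *)
Lemma norm_ge_sup : exists2 k, 0 < k & forall u, k * `|u| <= N u.
Proof.
pose S := [set u : 'rV[R]_2 | `|u| = 1].
have cS : compact S.
  apply: bounded_closed_compact; first by exists 1; split => // x x1 u; rewrite /S/= => ->; exact: ltW.
  have -> : S = (fun u : 'rV[R]_2 => `|u|) @^-1` [set 1] by [].
  by apply: closed_comp; [move=> ? _; exact: (@norm_continuous) | exact: closed_eq].
have S0 : S !=set0.
  exists (row2 1 0); apply/eqP; rewrite eq_le norm_le_coord/= ?row20 ?row21 ?normr1 ?normr0//.
  by have := coord_le_norm (row2 1 0) 0; rewrite row20 normr1.
have [|c cS1 cmin] := compact_EVT_min S0 cS (f := N).
  exact/continuous_subspaceT/is_norm_continuous.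
rewrite inE in cS1.
exists (N c) => [|u].
  by apply: norm_gt0; apply: contra_eq_neq cS1 => ->; rewrite normr0 eq_sym oner_eq0.
have [->|u0] := eqVneq u 0; first by rewrite normr0 mulr0 norm0.
have nu0 : 0 < `|u| by rewrite normr_gt0.
have := cmin (`|u|^-1 *: u); rewrite inE normZ ger0_norm ?invr_ge0// => h.
rewrite -ler_pdivlMr// mulrC; apply: h.
by rewrite /S/= normrZ ger0_norm ?invr_ge0// mulVf// gt_eqF.
Qed.
End NormFacts.

(** * Planar lattices and the quadratic form of an ellipsoid *)

Lemma int_sqr_eq1_or_ge4 (x : int) : x != 0 -> x ^+ 2 = 1 \/ 4 <= x ^+ 2.
Proof.
rewrite expr2 => x0.
have [->|[->|[h|h]]] : x = 1 \/ x = -1 \/ 2 <= x \/ x <= -2 by lia.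
- by left.
- by left.
- by right; nia.
- by right; nia.
Qed.

(** Equivalent to [(n + 2^-1) ^+ 2 >= 4^-1]: half-integers stay at distance at least [2^-1] from
    [0]. *)
Lemma int_mulS_ge0 (n : int) : 0 <= n * (n + 1).
Proof.
have [h|h] : 0 <= n \/ n <= -1 by lia.
  by nia.
by nia.
Qed.

Section Planar.
Context {R : realType}.
Implicit Types (u w : 'rV[R]_2) (a c D : R).

(** The tangent bound [y ^+ 2 >= y - 4^-1] at [y = 2^-1] avoids a case distinction on the sign of
    [2^-1 - z]. *)
Lemma sqr_add_ge_quarter (x e z : R) :
  2^-1 <= `|x| -> `|e| <= z -> 4^-1 - z <= (x + e) ^+ 2.
Proof.
move=> hx he; have : `|x| - `|e| <= `|x + e|.
  by have := ler_normB (x + e) e; rewrite addrK; lra.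
rewrite -(real_normK (num_real (x + e))); move: `|x + e| => y hy.
by have := sqr_ge0 (y - 2^-1); rewrite sqrrB expr2; lra.
Qed.

Definition det2 u w : R := u 0 0 * w 0 1 - u 0 1 * w 0 0.

Definition ellipsoid_dot a c u w : R := a * (u 0 0 * w 0 0) + c * (u 0 1 * w 0 1).

(** The first square records the position of the vector along its row parallel to [u], the second
    the distance of row [x] from the line of [u]. *)
Lemma lagrange_identity a c (x y : R) u w :
  ellipsoid_dot a c (x *: w + y *: u) (x *: w + y *: u) * ellipsoid_dot a c u u =
  (x * ellipsoid_dot a c w u + y * ellipsoid_dot a c u u) ^+ 2 +
  a * c * (x * det2 u w) ^+ 2.
Proof. rewrite /ellipsoid_dot /det2 !mxE; ring. Qed.

Lemma ellipsoid_dot_ge0 a c u : 0 < a -> 0 < c -> 0 <= ellipsoid_dot a c u u.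
Proof.
move=> a0 c0; by rewrite /ellipsoid_dot -!expr2 addr_ge0// mulr_ge0 ?sqr_ge0 ?ltW.
Qed.

Lemma ellipsoid_normE a c u :
  ellipsoid_norm a c u = Num.sqrt (ellipsoid_dot a c u u).
Proof. by rewrite /ellipsoid_norm /ellipsoid_dot !expr2. Qed.

Lemma ellipsoid_dot_gt0 a c u :
  0 < a -> 0 < c -> u != 0 -> 0 < ellipsoid_dot a c u u.
Proof.
move=> a0 c0 u0; rewrite lt_def ellipsoid_dot_ge0// andbT.
apply: contra_neq u0 => /eqP; rewrite /ellipsoid_dot.
rewrite -!expr2 paddr_eq0; last 2 first.
- by rewrite mulr_ge0 ?sqr_ge0 ?ltW.
- by rewrite mulr_ge0 ?sqr_ge0 ?ltW.
rewrite !mulf_eq0 (gt_eqF a0) (gt_eqF c0)/= !orbb => /andP[/eqP ? /eqP ?].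
by apply: row2P; rewrite mxE.
Qed.

(** For [det2 e1 e2 > 0] this is the open cone spanned by [e1] and [e2], written with two
    inequalities linear in [u]. *)
Definition in_cone e1 e2 u := 0 < det2 e1 u /\ 0 < det2 u e2.

Variables (N : 'rV[R]_2 -> R) (hN : is_norm N).
Variables (a c D : R) (hE : ellipsoid_params N a c D).

Lemma ellipsoid_sqr_le u :
  ellipsoid_dot a c u u <= N u ^+ 2 <= D ^+ 2 * ellipsoid_dot a c u u.
Proof.
case: hE => a0 c0 D1 /(_ u); rewrite ellipsoid_normE => /andP[h1 h2].
have E0 := ellipsoid_dot_ge0 u a0 c0.
have EE := sqr_sqrtr E0; rewrite -EE -exprMn.
rewrite !ler_sqr ?nnegrE ?sqrtr_ge0 ?norm_ge0 ?mulr_ge0 ?sqrtr_ge0//; first exact/andP.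
by apply: le_trans D1.
Qed.

(* Off the line of [u] the lattice vectors [x w + y u] lie in rows parallel to
   [u]; those in the nearest row are almost half-way between multiples of [u]. *)
Lemma row_gap (hi q z : R) (k : int) u w :
  u != 0 -> 0 < q -> 0 < z -> 0 < hi ->
  (D ^+ 2 - 4^-1 + 2 * z) * hi ^+ 4 <= a * c ->
  (q * det2 u w) ^+ 2 = 1 -> q * N u ^+ 2 <= hi ^+ 2 ->
  `|ellipsoid_dot a c w u / ellipsoid_dot a c u u - k%:~R - 2^-1| <= z ->
  exists2 gap, 0 < gap &
    forall x y : int, x != 0 -> N u + gap <= N (x%:~R *: w + y%:~R *: u).
Proof.
move=> u0 q0 z0 hi0 hz hdet hq hk.
have [a0 c0 D1 _] := hE.
set P := ellipsoid_dot a c u u; have P0 : 0 < P by exact: ellipsoid_dot_gt0.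
have /andP[hP1 hP2] := ellipsoid_sqr_le u; rewrite -/P in hP1 hP2.
set t := ellipsoid_dot a c w u in hk *; rewrite -/P in hk.
(* By [hdet] the covolume is [1 / q], so the bound on [q * N u ^+ 2] makes the rows far apart
   compared with [P]. *)
have acdet : (D ^+ 2 - 4^-1 + 2 * z) * P ^+ 2 <= a * c * (det2 u w) ^+ 2.
  have qP : q * P <= hi ^+ 2 by apply: le_trans hq; rewrite ler_pM2l.
  have qP2 : q ^+ 2 * P ^+ 2 <= hi ^+ 4.
    rewrite -exprMn (exprM hi 2 2) ler_sqr ?nnegrE//; first nra.
    exact: sqr_ge0.
  have E0 : 0 <= D ^+ 2 - 4^-1 + 2 * z by nra.
  have : (D ^+ 2 - 4^-1 + 2 * z) * (q ^+ 2 * P ^+ 2) <= a * c.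
    by apply: le_trans hz; rewrite ler_wpM2l.
  rewrite exprMn in hdet.
  have q20 : 0 < q ^+ 2 by rewrite exprn_gt0.
  move=> h; rewrite -(ler_pM2l q20) [leRHS]mulrCA hdet mulr1.
  by apply: le_trans h; rewrite mulrCA.
have key (x y : int) : x != 0 ->
    (D ^+ 2 + z) * P <= ellipsoid_dot a c (x%:~R *: w + y%:~R *: u) (x%:~R *: w + y%:~R *: u).
  move=> x0; rewrite -(ler_pM2r P0) lagrange_identity -/P -/t.
  (* In rows [1] and [-1] the half-way position supplies the missing [P / 4]; in the others
     [x ^+ 2 >= 4] quadruples the determinant term, which then suffices alone. *)
  have [x1|x2] := int_sqr_eq1_or_ge4 x0.
  - have x1R : x%:~R ^+ 2 = 1 :> R by rewrite -rmorphXn/= x1.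
    have -> : a * c * (x%:~R * det2 u w) ^+ 2 = a * c * (det2 u w) ^+ 2.
      by rewrite exprMn x1R mul1r.
    have {}hk : exists2 e : R, `|e| <= z & t = (k%:~R + 2^-1 + e) * P.
      by exists (t / P - k%:~R - 2^-1) => //; field; rewrite gt_eqF.
    case: hk => e ez tE.
    (* As [x ^+ 2 = 1], moving by [y] along the row only changes the integer [k] into
       [k + x * y]. *)
    have -> : (x%:~R * t + y%:~R * P) ^+ 2 = ((k + x * y)%:~R + 2^-1 + e) ^+ 2 * P ^+ 2.
      have -> : x%:~R * t + y%:~R * P = x%:~R * (((k + x * y)%:~R + 2^-1 + e) * P).
        have yE : y%:~R = x%:~R ^+ 2 * y%:~R :> R by rewrite x1R mul1r.
        rewrite tE rmorphD rmorphM/= [y%:~R in LHS]yE; ring.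
      by rewrite exprMn x1R mul1r exprMn.
    move: (k + x * y) => n.
    have n2 : 4^-1 <= (n%:~R + 2^-1 : R) ^+ 2.
      have := int_mulS_ge0 n; rewrite -(ler_int R) rmorphM rmorphD/=.
      rewrite (_ : (_ + _) ^+ 2 = n%:~R * (n%:~R + 1) + 4^-1 :> R); last by field.
      by lra.
    have : 4^-1 - z <= ((n%:~R : R) + 2^-1 + e) ^+ 2.
      have : 2^-1 <= `|(n%:~R + 2^-1 : R)|.
        rewrite -(ler_sqr) ?nnegrE// real_normK ?num_real//.
        by rewrite (_ : 2^-1 ^+ 2 = 4^-1 :> R)//; field.
      by move=> h; exact: sqr_add_ge_quarter.
    move=> h; have : (4^-1 - z) * P ^+ 2 <= ((n%:~R : R) + 2^-1 + e) ^+ 2 * P ^+ 2.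
      by rewrite ler_pM2r// exprn_gt0.
    nra.
  - have {}x2 : 4 <= x%:~R ^+ 2 :> R by rewrite -rmorphXn/= (ler_int R 4).
    have := sqr_ge0 (x%:~R * t + y%:~R * P); rewrite exprMn.
    have P20 : 0 < P ^+ 2 by rewrite exprn_gt0.
    have D2 : 1 <= D ^+ 2 by rewrite exprn_ege1.
    have h : (D ^+ 2 - 4^-1 + 2 * z) * P ^+ 2 * 4 <= a * c * det2 u w ^+ 2 * x%:~R ^+ 2.
      by rewrite ler_pM// mulr_ge0 ?(ltW P20)//; lra.
    have h' : 0 <= (3 * D ^+ 2 - 1 + 7 * z) * P ^+ 2.
      by rewrite mulr_ge0 ?(ltW P20)//; lra.
    move=> h0; rewrite (mulrC (x%:~R ^+ 2)) (mulrA (a * c)).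
    have -> : (D ^+ 2 + z) * P * P = (D ^+ 2 + z) * P ^+ 2 by ring.
    by apply: le_trans (_ : _ <= a * c * det2 u w ^+ 2 * x%:~R ^+ 2) _; lra.
(* Since [N u ^+ 2 <= D ^+ 2 * P], [key] bounds the squared norm below by [N u ^+ 2 + z * P]. *)
exists (Num.sqrt (N u ^+ 2 + z * P) - N u) => [|x y x0].
  rewrite subr_gt0 -{1}(ger0_norm (norm_ge0 hN u)) -sqrtr_sqr ltr_sqrt; nra.
rewrite addrC subrK -[leRHS](ger0_norm (norm_ge0 hN _)) -sqrtr_sqr ler_wsqrtr//.
have /andP[h _] := ellipsoid_sqr_le (x%:~R *: w + y%:~R *: u).
have := key x y x0; nra.
Qed.

End Planar.

(** * Integers in a residue class with prescribed size and phase *)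

Section Selection.
Context {R : realType}.

Lemma ex_int_congr_ge (m : nat) (r : int) (x : R) : (0 < m)%N ->
  exists s : int, (s = r %[mod m%:Z])%Z /\ x < s%:~R <= x + m%:R.
Proof.
move=> m0; have mR0 : 0 < m%:R :> R by rewrite ltr0n.
pose k := Num.floor ((x - r%:~R) / m%:R).
have := floor_itv ((x - r%:~R) / m%:R); rewrite -/k => /andP[k1 k2].
exists (r + (k + 1) * m%:Z); split; first by rewrite addrC modzMDl.
rewrite !rmorphD rmorphM rmorphD/= -pmulrn.
move: k1 k2; rewrite rmorphD/= ler_pdivlMr// ltr_pdivrMr// => k1 k2.
by apply/andP; split; lra.
Qed.

(** Each increase of [s] by [m] lowers [t - rho * s] by [m * rho], so a half-integer is approached
    within [m * rho] before one period [rho^-1] has elapsed. *)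
Lemma ex_int_congr_half (m : nat) (r : int) (x t rho : R) : (0 < m)%N -> 0 < rho ->
  exists s k : int, [/\ (s = r %[mod m%:Z])%Z,
    x < s%:~R <= x + m%:R + rho^-1 &
    `|t - rho * s%:~R - k%:~R - 2^-1| <= m%:R * rho].
Proof.
move=> m0 rho0; have [s1 [s1r /andP[xs1 s1x]]] := ex_int_congr_ge r x m0.
have mR0 : 0 < m%:R :> R by rewrite ltr0n.
have mrho : 0 < m%:R * rho by exact: mulr_gt0.
pose y0 := t - rho * s1%:~R - 2^-1.
pose k := Num.floor y0.
have := floor_itv y0; rewrite -/k rmorphD/= => /andP[k1 k2].
pose l := Num.floor ((y0 - k%:~R) / (m%:R * rho)).
have := floor_itv ((y0 - k%:~R) / (m%:R * rho)).
rewrite -/l rmorphD/= ler_pdivlMr// ltr_pdivrMr// => /andP[l1 l2].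
have l0 : 0 <= l by rewrite floor_ge0 divr_ge0// ?subr_ge0// ltW.
have lR0 : 0 <= l%:~R :> R by rewrite ler0z.
exists (s1 + l * m%:Z), k; split; first by rewrite addrC modzMDl.
  rewrite rmorphD rmorphM/= -pmulrn.
  have : l%:~R * m%:R <= rho^-1.
    rewrite -(ler_pM2r rho0) mulVf ?gt_eqF//.
    by lra.
  by have := mulr_ge0 lR0 (ltW mR0) => ? ?; apply/andP; split; lra.
rewrite rmorphD rmorphM/= -pmulrn.
rewrite ler_norml; move: l1 l2; rewrite /y0 => l1 l2; apply/andP; split; lra.
Qed.

End Selection.

(** * Projections of the integer lattice of rank three to the plane *)

Section Displacement.
Context {R : realType}.
Implicit Types (v w : 'rV[R]_2) (x y z : int * 'rV[int]_2).

(* A pair [(q, p)] stands for a vector of Z^3; [disp v] is the projection of Z^3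
   along [(1, v)] to the plane. *)
Definition disp v x : 'rV[R]_2 := x.1%:~R *: v - int_vec x.2.

(** When [x.1 != 0], the vector [x] is proportional to [(1, center x)], so projecting along it sends
    [x] to [0]. *)
Definition center x : 'rV[R]_2 := x.1%:~R^-1 *: int_vec x.2.

Definition lincomb (a b c : int) x y z : int * 'rV[int]_2 :=
  (a * x.1 + b * y.1 + c * z.1, a *: x.2 + b *: y.2 + c *: z.2).

Lemma disp_lincomb v a b c x y z :
  disp v (lincomb a b c x y z) =
  a%:~R *: disp v x + b%:~R *: disp v y + c%:~R *: disp v z.
Proof. by apply: row2P; rewrite !mxE/= !rmorphD !rmorphM/=; ring. Qed.

Lemma disp_center x : x.1 != 0 -> disp (center x) x = 0.
Proof.
by move=> x0; rewrite /disp scalerA mulfV ?intr_eq0// scale1r subrr.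
Qed.

Lemma disp_shift v w x : disp w x = disp v x + x.1%:~R *: (w - v).
Proof. by apply: row2P; rewrite !mxE; ring. Qed.

Lemma center_sub h b : h.1 != 0 -> b.1 != 0 ->
  center b - center h = - b.1%:~R^-1 *: disp (center h) b.
Proof.
move=> h0 b0; have bR : b.1%:~R != 0 :> R by rewrite intr_eq0.
have := disp_shift (center h) (center b) b; rewrite disp_center// => E.
apply: (scalerI bR); rewrite scalerA mulrN mulfV// scaleN1r.
by apply/eqP; rewrite -addr_eq0 addrC -E.
Qed.

(** Moving the centre changes [disp v x] by [x.1] times a fixed vector, and that vector is found by
    requiring that [b] go to [0]. *)
Lemma disp_center_eq h b x : h.1 != 0 -> b.1 != 0 ->
  disp (center b) x =
  disp (center h) x - (x.1%:~R / b.1%:~R) *: disp (center h) b.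
Proof.
by move=> h0 b0; rewrite (disp_shift (center h)) center_sub// scalerA mulrN scaleNr.
Qed.

End Displacement.

(** * Effect of a large coefficient [I] on norms and projections *)

Section Estimates.
Context {R : realType}.
Variables (N : 'rV[R]_2 -> R) (hN : is_norm N).
Variables (a c D : R) (hE : ellipsoid_params N a c D).
Variables (G F : 'rV[R]_2) (I sg : R).
Hypotheses (G0 : G != 0) (I1 : 1 < I) (sg1 : `|sg| = 1).
Let W := I *: G + sg *: F.

Let I0 : 0 < I. Proof. exact: lt_trans I1. Qed.

Lemma norm_combination : 2 * N F < I * N G ->
  I * N G / 2 <= N W <= 2 * I * N G.
Proof.
move=> h; have NF : N (sg *: F) = N F by rewrite normZ// sg1 mul1r.
have NG : N (I *: G) = I * N G by rewrite normZ// gtr0_norm.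
have := normD hN (I *: G) (sg *: F); have := normB_ge hN (I *: G) (- (sg *: F)).
by rewrite opprK normN// NF NG -/W => h1 h2; apply/andP; split; lra.
Qed.

Let rho := ellipsoid_dot a c G W / ellipsoid_dot a c W W.

(** [rho] is the coefficient of the orthogonal projection of [G] on [W], hence of order [1 / I]. The
    upper bound makes the row shift fine, the lower bound keeps its period [rho^-1] of order at most
    [I]. *)
Lemma projection_bounds : 2 * N F < I * N G ->
  2 * `|ellipsoid_dot a c G F| < I * ellipsoid_dot a c G G ->
  ellipsoid_dot a c G G / (8 * N G ^+ 2 * I) <= rho <=
  6 * D ^+ 2 * ellipsoid_dot a c G G / (N G ^+ 2 * I).
Proof.
move=> /norm_combination/andP[W1 W2] hGF.
have [a0 c0 D1 _] := hE.
have NG0 := norm_gt0 hN G0.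
have W0 : W != 0.
  apply/eqP => W0; move: W1; rewrite W0 (norm0 hN) leNgt.
  by rewrite divr_gt0// mulr_gt0.
have SW := ellipsoid_dot_gt0 a0 c0 W0.
have SG := ellipsoid_dot_gt0 a0 c0 G0.
have /andP[SW1 SW2] := ellipsoid_sqr_le hN hE W.
have GW : ellipsoid_dot a c G W =
    I * ellipsoid_dot a c G G + sg * ellipsoid_dot a c G F.
  by rewrite /ellipsoid_dot /W !mxE; ring.
have GW1 : `|sg * ellipsoid_dot a c G F| <= `|ellipsoid_dot a c G F|.
  by rewrite normrM sg1 mul1r.
have /andP[GW2 GW3] : I * ellipsoid_dot a c G G / 2 <= ellipsoid_dot a c G W <=
    3 / 2 * (I * ellipsoid_dot a c G G).
  by move: GW1; rewrite ler_norml GW => /andP[? ?]; apply/andP; split; lra.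
have W1' : (I * N G / 2) ^+ 2 <= N W ^+ 2.
  by rewrite ler_sqr ?nnegrE ?norm_ge0// divr_ge0// mulr_ge0// ltW.
have W2' : N W ^+ 2 <= (2 * I * N G) ^+ 2.
  by rewrite ler_sqr ?nnegrE ?norm_ge0// !mulr_ge0// ltW.
have NGI : 0 < N G ^+ 2 * I by rewrite mulr_gt0// exprn_gt0.
have D20 : 0 < D ^+ 2 by rewrite exprn_gt0//; lra.
apply/andP; split.
  rewrite /rho ler_pdivlMr// mulrAC ler_pdivrMr; last by rewrite -mulrA mulr_gt0.
  have h1 : ellipsoid_dot a c G G * ellipsoid_dot a c W W <=
      ellipsoid_dot a c G G * (2 * I * N G) ^+ 2.
    by rewrite ler_pM2l//; exact: le_trans W2'.
  have h2 := ler_wpM2r (ltW NGI) GW2.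
  by apply: (le_trans h1); lra.
rewrite /rho ler_pdivrMr// mulrAC ler_pdivlMr//.
have h1 := ler_wpM2r (ltW NGI) GW3.
have h2 : ellipsoid_dot a c G G * (I * N G / 2) ^+ 2 <=
    ellipsoid_dot a c G G * (D ^+ 2 * ellipsoid_dot a c W W).
  by rewrite ler_pM2l//; exact: le_trans SW2.
by apply: (le_trans h1); lra.
Qed.

(** Up to a multiple of [F], [Y] is [(1 - t * e) *: G] and [X - Y] is [- (1 + (1 - t) * e) *: G].
    The two norm estimates differ by [e * N G - e / I * N F], positive by the bound on [N F]. *)
Lemma norm_successive (e t : R) : 0 < e -> 0 <= t <= 1 ->
  N F < I * N G -> 2 * e * (N G + N F) < N G ->
  let X := - (e / I) *: W in let Y := G + t *: X in
  N X < N Y /\ N Y < N (X - Y).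
Proof.
move=> e0 /andP[t0 t1] hF he X Y.
have NG0 := norm_gt0 hN G0; have NF0 := norm_ge0 hN F.
have NFs k : N (k *: (sg *: F)) = `|k| * N F by rewrite !normZ// sg1 mul1r.
have eI : 0 < e / I by exact: divr_gt0.
have eIe : e / I <= e by rewrite ler_pdivrMr// ler_peMr// ltW.
have XE : X = - e *: G - (e / I) *: (sg *: F).
  by apply: row2P; rewrite !mxE; field; rewrite gt_eqF.
have NX : N X <= e * (N G + N F).
  rewrite XE; apply: (le_trans (normD hN _ _)).
  rewrite normN// NFs normZ// normrN !gtr0_norm//; nra.
have NX0 := norm_ge0 hN X.
have NY : N G - N X <= N Y.
  have := normB_ge hN G (- (t *: X)); rewrite opprK -/Y normN// normZ// ger0_norm//; nra.
split; first by lra.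
have eeN : e / I * N F < e * N G.
  by rewrite mulrAC ltr_pdivrMr// -mulrA ltr_pM2l// mulrC.
have e1 : e < 1 by nra.
have YE : Y = (1 - t * e) *: G + - (t * (e / I)) *: (sg *: F).
  by rewrite /Y XE; apply: row2P; rewrite !mxE; ring.
have XYE : X - Y = - (1 + (1 - t) * e) *: G - ((1 - t) * (e / I)) *: (sg *: F).
  by rewrite YE XE; apply: row2P; rewrite !mxE; ring.
have te : t * e <= 1 by nra.
have h1 : N Y <= (1 - t * e) * N G + t * (e / I) * N F.
  rewrite YE; apply: (le_trans (normD hN _ _)).
  by rewrite NFs normZ// normrN !ger0_norm ?subr_ge0// mulr_ge0// ltW.
have h2 : (1 + (1 - t) * e) * N G - (1 - t) * (e / I) * N F <= N (X - Y).
  rewrite XYE; apply: le_trans (normB_ge hN _ _).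
  have u1 : 0 <= (1 - t) * e by rewrite mulr_ge0 ?subr_ge0// ltW.
  have u2 : 0 <= (1 - t) * (e / I) by rewrite mulr_ge0 ?subr_ge0// ltW.
  have u3 : 0 <= 1 + (1 - t) * e by lra.
  by rewrite NFs normZ// normrN (ger0_norm u2) (ger0_norm u3).
by lra.
Qed.

End Estimates.

(** * One step of the construction: choice of [i] and [s] *)

Section Step.
Context {R : realType}.
Variables (N : 'rV[R]_2 -> R) (hN : is_norm N).
Variables (a c D : R) (hE : ellipsoid_params N a c D).

Lemma det2Dr (u w w' : 'rV[R]_2) (x y : R) :
  det2 u (x *: w + y *: w') = x * det2 u w + y * det2 u w'.
Proof. by rewrite /det2 !mxE; ring. Qed.

Lemma det2Dl (u w w' : 'rV[R]_2) (x y : R) :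
  det2 (x *: w + y *: w') u = x * det2 w u + y * det2 w' u.
Proof. by rewrite /det2 !mxE; ring. Qed.

Lemma det2Zr (u w : 'rV[R]_2) (x : R) : det2 u (x *: w) = x * det2 u w.
Proof. by rewrite /det2 !mxE; ring. Qed.

Lemma det2Zl (u w : 'rV[R]_2) (x : R) : det2 (x *: w) u = x * det2 w u.
Proof. by rewrite /det2 !mxE; ring. Qed.

Lemma in_coneD (e1 e2 u w : 'rV[R]_2) (I sg : R) : `|sg| = 1 -> 0 < I ->
  in_cone e1 e2 u -> `|det2 e1 w| < I * det2 e1 u ->
  `|det2 w e2| < I * det2 u e2 -> in_cone e1 e2 (I *: u + sg *: w).
Proof.
move=> sg1 I0 [h1 h2] h3 h4; split; rewrite ?det2Dr ?det2Dl.
  have : `|sg * det2 e1 w| = `|det2 e1 w| by rewrite normrM sg1 mul1r.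
  by have := ler_norm (- (sg * det2 e1 w)); rewrite normrN; lra.
have : `|sg * det2 w e2| = `|det2 w e2| by rewrite normrM sg1 mul1r.
by have := ler_norm (- (sg * det2 w e2)); rewrite normrN; lra.
Qed.

Lemma in_coneZ (e1 e2 u : 'rV[R]_2) (k : R) : 0 < k ->
  in_cone e1 e2 u -> in_cone e1 e2 (k *: u).
Proof.
by move=> k0 [h1 h2]; split; rewrite ?det2Zr ?det2Zl mulr_gt0.
Qed.

(** The displacement of [b] at [center h] is [i G + sg F], whatever [s] is. Hence [i] is fixed
    first, large enough for all comparisons of size and direction; [s] then adjusts [b.1] and the
    phase of the rows. The sign of [kap] changes because [X] is a negative multiple of that
    displacement. *)
Lemma step_geometry (lo hi : R) (e1 e2 : 'rV[R]_2) (kap : R) (m : nat)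
    (f g h : int * 'rV[int]_2) (r K : R) (s0 i0 sg : int) :
  let G := disp (center h) g in let F := disp (center h) f in
  0 < lo < hi -> (4 * D ^+ 2 - 1) * hi ^+ 4 < 4 * a * c ->
  (0 < m)%N -> 0 <= g.1 -> g.1 < h.1 -> (h.1%:~R * det2 G F) ^+ 2 = 1 ->
  in_cone e1 e2 (kap *: G) -> 0 < r -> `|sg| = 1 ->
  exists s i : int,
    let b := lincomb s i sg h g f in
    let X := disp (center b) h in let Y := disp (center b) g in
    [/\ (s = s0 %[mod m%:Z])%Z & (i = i0 %[mod m%:Z])%Z] /\
    [/\ K < b.1%:~R, h.1 < b.1, N (center b - center h) < r,
        lo < Num.sqrt b.1%:~R * N X < hi & in_cone e1 e2 (- kap *: X)] /\
    [/\ N X < N Y, N Y < N (X - Y), (b.1%:~R * det2 X Y) ^+ 2 = 1 &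
        exists2 gap, 0 < gap & forall x y : int, x != 0 ->
          N X + gap <= N (x%:~R *: Y + y%:~R *: X)].
Proof.
move=> G F /andP[lo0 lohi] hiM m0 g0 gh hdet [cone1 cone2] r0 sg1.
have [a0 c0 D1 _] := hE.
have G0 : G != 0.
  by apply/eqP => G0; move: cone1; rewrite G0 scaler0 /det2 !mxE !mulr0 subrr ltxx.
have hi0 : 0 < hi by apply: lt_trans lohi.
have h0 : 0 < h.1 by apply: le_lt_trans gh.
have NG0 := norm_gt0 hN G0; have NF0 := norm_ge0 hN F.
have SG := ellipsoid_dot_gt0 a0 c0 G0.
have sgR : `|sg%:~R| = 1 :> R by rewrite -intr_norm sg1.
set qh : R := h.1%:~R; have qh0 : 0 < qh by rewrite ltr0z.
set qg : R := g.1%:~R; set qf : R := f.1%:~R.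
have mR0 : 0 < m%:R :> R by rewrite ltr0n.
(* Half of the slack in [hiM] after division by [4 * hi ^+ 4]: the tolerance for missing the
   half-way position. *)
pose z := (a * c / hi ^+ 4 - (D ^+ 2 - 4^-1)) / 2.
have hi4 : 0 < hi ^+ 4 by exact: exprn_gt0.
have z0 : 0 < z.
  by rewrite /z divr_gt0// subr_gt0 ltr_pdivlMr//; lra.
have zE : (D ^+ 2 - 4^-1 + 2 * z) * hi ^+ 4 <= a * c.
  by rewrite /z le_eqVlt; apply/orP; left; apply/eqP; field; rewrite gt_eqF.
clearbody z.
(* For [A] and [q] as below, [q * N X ^+ 2 = A / q], so [q] may range over an interval of length
   [A * w]. *)
pose w := lo ^- 2 - hi ^- 2.
have w0 : 0 < w by rewrite /w subr_gt0 ltf_pV2 ?posrE ?exprn_gt0// ltr_sqr ?nnegrE ?ltW.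
(* Lower bounds for [I]: [b1] and [b2] make [I *: G] dominate in norm and in inner product; [b3]
   gives [m * rho <= z]; [b4] fits a whole period into the range of [q]; [b5] makes [b.1] exceed [K]
   and [h.1]; [b6] keeps [center b] near [center h]; [b7] and [b8] preserve the cone; [b9] gives the
   comparisons of [X], [Y] and [X - Y]. *)
pose b1 := 2 * N F / N G.
pose b2 := 2 * `|ellipsoid_dot a c G F| / ellipsoid_dot a c G G.
pose b3 := 6 * m%:R * D ^+ 2 * ellipsoid_dot a c G G / (N G ^+ 2 * z).
pose b4 := (m%:R + 8 * N G ^+ 2 / ellipsoid_dot a c G G) * 4 / (qh * N G ^+ 2 * w).
pose b5 := 4 * hi ^+ 2 * (`|K| + qh) / (qh ^+ 2 * N G ^+ 2).
pose b6 := 8 * hi ^+ 2 / (qh ^+ 2 * N G * r).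
pose b7 := `|det2 e1 (kap *: F)| / det2 e1 (kap *: G).
pose b8 := `|det2 (kap *: F) e2| / det2 (kap *: G) e2.
pose b9 := 8 * hi ^+ 2 * (N G + N F) / (qh * N G ^+ 3).
have [i [ii0 /andP[]]] := ex_int_congr_ge i0
  (Num.max 1 (Num.max b1 (Num.max b2 (Num.max b3 (Num.max b4 (Num.max b5
    (Num.max b6 (Num.max b7 (Num.max b8 b9))))))))) m0.
rewrite !gt_max; set I : R := i%:~R.
move=> /and5P[I1 B1 B2 B3 /and5P[B4 B5 B6 B7 /andP[B8 B9]]] _.
have I0 : 0 < I by exact: lt_trans I1.
rewrite /b1 ltr_pdivrMr// in B1; rewrite /b2 ltr_pdivrMr// in B2.
rewrite /b3 ltr_pdivrMr ?mulr_gt0 ?exprn_gt0// in B3.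
rewrite /b4 ltr_pdivrMr ?mulr_gt0 ?exprn_gt0// in B4.
rewrite /b5 ltr_pdivrMr ?mulr_gt0 ?exprn_gt0// in B5.
rewrite /b6 ltr_pdivrMr ?mulr_gt0 ?exprn_gt0// in B6.
rewrite /b7 ltr_pdivrMr// in B7; rewrite /b8 ltr_pdivrMr// in B8.
rewrite /b9 ltr_pdivrMr ?mulr_gt0 ?exprn_gt0// in B9.
move: b1 b2 b3 b4 b5 b6 b7 b8 b9 => _ _ _ _ _ _ _ _ _.
pose W := I *: G + sg%:~R *: F.
have /andP[W1 W2] := norm_combination hN I1 sgR B1.
have /andP[rho1 rho2] := projection_bounds hN hE G0 I1 sgR B1 B2.
rewrite -/W in W1 W2 rho1 rho2.
set rho := ellipsoid_dot a c G W / ellipsoid_dot a c W W in rho1 rho2.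
have NW0 : 0 < N W by apply: lt_le_trans W1; rewrite divr_gt0// mulr_gt0.
have W0 : W != 0 by apply/eqP => W0; move: NW0; rewrite W0 norm0// ltxx.
have rho0 : 0 < rho.
  by apply: lt_le_trans rho1; rewrite divr_gt0// !mulr_gt0// exprn_gt0.
pose A := qh ^+ 2 * N W ^+ 2.
have A0 : 0 < A by rewrite mulr_gt0// exprn_gt0.
pose base := I * qg + sg%:~R * qf.
(* [rho] is of order [1/i], so the range of [s] allowed by [lo] and [hi], of
   length of order [i^2], contains many full periods [1/rho] of the row shift. *)
have [s [k [ss0 /andP[s1 s2] hk]]] := ex_int_congr_half s0
  ((A / hi ^+ 2 - base) / qh) (qg / qh - base / qh * rho) m0 rho0.
exists s, i; cbv zeta; set b := lincomb s i sg h g f.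
pose q : R := b.1%:~R.
have qE : q = s%:~R * qh + base.
  by rewrite /q /b /lincomb/= !rmorphD !rmorphM/= /base addrA.
have W12 : (I * N G / 2) ^+ 2 <= N W ^+ 2.
  by rewrite ler_sqr ?nnegrE ?norm_ge0// divr_ge0// mulr_ge0// ltW.
have hi20 : 0 < hi ^+ 2 by rewrite exprn_gt0.
have lo20 : 0 < lo ^+ 2 by rewrite exprn_gt0.
have qhi : A / hi ^+ 2 < q by move: s1; rewrite ltr_pdivrMr// qE; clear; lra.
have q0 : 0 < q by apply: lt_trans qhi; rewrite divr_gt0.
have rhoV : rho^-1 <= 8 * N G ^+ 2 * I / ellipsoid_dot a c G G.
  by rewrite -[leRHS]invf_div lef_pV2 ?posrE// divr_gt0// !mulr_gt0// exprn_gt0.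
have qlo : q < A / lo ^+ 2.
  have h1 : q <= A / hi ^+ 2 + qh * (m%:R + rho^-1).
    move: s2; rewrite -addrA -lerBlDr ler_pdivlMr// qE; clear; lra.
  apply: (le_lt_trans h1).
  have -> : A / lo ^+ 2 = A / hi ^+ 2 + A * w by rewrite /w; ring.
  rewrite ltrD2l.
  have h2 : m%:R + rho^-1 <= I * (m%:R + 8 * N G ^+ 2 / ellipsoid_dot a c G G).
    rewrite mulrDr lerD//; first by rewrite ler_peMl// ltW.
    by apply: (le_trans rhoV); rewrite le_eqVlt; apply/orP; left; apply/eqP; ring.
  have h3 : qh * (m%:R + rho^-1) <=
      qh * (I * (m%:R + 8 * N G ^+ 2 / ellipsoid_dot a c G G)) by rewrite ler_pM2l.
  apply: (le_lt_trans h3).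
  have qhI : 0 < qh * I by exact: mulr_gt0.
  have h4 := B4; rewrite -(ltr_pM2l qhI) in h4.
  have h5 : qh ^+ 2 * w * (I * N G / 2) ^+ 2 <= qh ^+ 2 * w * N W ^+ 2.
    by rewrite ler_pM2l// mulr_gt0// exprn_gt0.
  by rewrite /A; move: h4 h5; clear; lra.
(* [q] grows at least like [I ^+ 2], so [B5], [B6] and [B9], linear in [I], become estimates in
   terms of [q]. *)
have qlow : qh ^+ 2 * (I ^+ 2 * N G ^+ 2) < 4 * hi ^+ 2 * q.
  move: qhi; rewrite ltr_pdivrMr// => h1.
  have h2 : qh ^+ 2 * (I * N G / 2) ^+ 2 <= A by rewrite ler_pM2l// exprn_gt0.
  by move: h1 h2; rewrite !exprMn; clear; lra.
have qKh : `|K| + qh < q.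
  have h1 : I * (qh ^+ 2 * N G ^+ 2) <= qh ^+ 2 * (I ^+ 2 * N G ^+ 2).
    have -> : qh ^+ 2 * (I ^+ 2 * N G ^+ 2) = I * (I * (qh ^+ 2 * N G ^+ 2)) by ring.
    by rewrite ler_pM2l// ler_peMl ?(ltW I1)// mulr_ge0// ltW// exprn_gt0.
  rewrite -(ltr_pM2l (_ : 0 < 4 * hi ^+ 2)); last by rewrite mulr_gt0.
  by move: h1 B5 qlow; clear; lra.
have b0 : b.1 != 0 by rewrite -(intr_eq0 R) gt_eqF.
have hn0 : h.1 != 0 by rewrite gt_eqF.
have dispb : disp (center h) b = W.
  by rewrite disp_lincomb disp_center// scaler0 add0r.
set X := disp (center b) h; set Y := disp (center b) g.
have XE : X = - (qh / q) *: W.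
  by rewrite /X (disp_center_eq _ hn0 b0) disp_center// dispb sub0r scaleNr.
have YE : Y = G + (qg / qh) *: X.
  rewrite /Y (disp_center_eq _ hn0 b0) dispb XE scalerA -/G -/qg -/q -scaleNr.
  by congr (_ + _ *: _); field; rewrite !gt_eqF.
have qne : q != 0 by rewrite gt_eqF.
have qhne : qh != 0 by rewrite gt_eqF.
have NX : N X = qh / q * N W.
  by rewrite XE normZ// normrN gtr0_norm// divr_gt0.
have X0 : X != 0.
  by rewrite XE scaler_eq0 negb_or W0 oppr_eq0 mulf_neq0// invr_neq0.
have qNX : q * N X ^+ 2 = A / q by rewrite NX /A; field.
have sqlo : lo ^+ 2 < q * N X ^+ 2 < hi ^+ 2.
  rewrite qNX ltr_pdivlMr// ltr_pdivrMr//.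
  move: qhi qlo; rewrite ltr_pdivrMr// ltr_pdivlMr// => h1 h2.
  by rewrite mulrC h2 mulrC h1.
have XdetY : (q * det2 X Y) ^+ 2 = 1.
  rewrite -hdet; have -> : q * det2 X Y = sg%:~R * (qh * det2 G F).
    rewrite YE XE /W /det2 !mxE; field; exact/andP.
  by rewrite exprMn -(real_normK (num_real (sg%:~R))) sgR expr1n mul1r.
(* The phase is affine in [s] with slope [- rho]; [hk] places exactly this value within [m * rho] of
   a half-integer. *)
have Xdot : ellipsoid_dot a c Y X / ellipsoid_dot a c X X =
    qg / qh - base / qh * rho - rho * s%:~R.
  have SW : ellipsoid_dot a c W W != 0 by rewrite gt_eqF// ellipsoid_dot_gt0.
  have -> : ellipsoid_dot a c X X = (qh / q) ^+ 2 * ellipsoid_dot a c W W.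
    by rewrite XE /ellipsoid_dot !mxE; ring.
  have -> : ellipsoid_dot a c Y X =
      - (qh / q) * (ellipsoid_dot a c G W - qg / q * ellipsoid_dot a c W W).
    by rewrite YE XE /ellipsoid_dot !mxE; field; exact/andP.
  rewrite /rho; have -> : base = q - s%:~R * qh by rewrite qE; ring.
  by field; rewrite SW qne qhne.
have eE : X = - (qh * I / q / I) *: W.
  by rewrite XE; congr (- _ *: _); field; rewrite qne gt_eqF.
have [NXY NYX] : N X < N Y /\ N Y < N (X - Y).
  have e0 : 0 < qh * I / q by rewrite divr_gt0// mulr_gt0.
  have t01 : 0 <= qg / qh <= 1.
    rewrite divr_ge0 ?ler0z ?(ltW h0)//= ler_pdivrMr// mul1r ler_int; exact: ltW.
  have NFI : N F < I * N G by move: B1 NF0; clear; lra.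
  have small : 2 * (qh * I / q) * (N G + N F) < N G.
    rewrite -[X in X < _](_ : (2 * qh * I * (N G + N F)) / q = _); last by ring.
    rewrite ltr_pdivrMr// -(ltr_pM2l (_ : 0 < 4 * hi ^+ 2)); last by rewrite mulr_gt0.
    have h1 := B9; rewrite -(ltr_pM2l (mulr_gt0 qh0 I0)) in h1.
    have h2 := qlow; rewrite -(ltr_pM2l NG0) in h2.
    by move: h1 h2; clear; lra.
  have := norm_successive hN G0 I1 sgR e0 t01 NFI small; cbv zeta.
  by rewrite -/W -eE -YE.
split; first by [].
split.
- split=> //.
  + by apply: le_lt_trans qKh; rewrite (le_trans (ler_norm K))// lerDl ltW.
  + by rewrite -(ltr_int R); apply: le_lt_trans qKh; rewrite lerDr.
  + rewrite center_sub// dispb normZ// normrN gtr0_norm ?invr_gt0// mulrC -/q.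
    rewrite ltr_pdivrMr//; apply: le_lt_trans W2 _.
    rewrite -(ltr_pM2l (_ : 0 < 4 * hi ^+ 2)); last by rewrite mulr_gt0.
    have h1 := B6; rewrite -(ltr_pM2l (mulr_gt0 I0 NG0)) in h1.
    have h2 := qlow; rewrite -(ltr_pM2l r0) in h2.
    by move: h1 h2; clear; lra.
  + have sq0 : 0 <= Num.sqrt q * N X by rewrite mulr_ge0 ?sqrtr_ge0 ?norm_ge0.
    have sqE : (Num.sqrt q * N X) ^+ 2 = q * N X ^+ 2.
      by rewrite exprMn sqr_sqrtr// ltW.
    case/andP: sqlo; rewrite -sqE !ltr_sqr ?nnegrE ?(ltW lo0) ?(ltW hi0)//.
    by move=> -> ->.
  + have -> : - kap *: X = (qh / q) *: (I *: (kap *: G) + sg%:~R *: (kap *: F)).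
      by rewrite XE /W; apply: row2P; rewrite !mxE; ring.
    by apply: in_coneZ; [rewrite divr_gt0|apply: in_coneD].
split=> //.
have hq : q * N X ^+ 2 <= hi ^+ 2 by case/andP: sqlo => _ /ltW.
apply: (row_gap hN hE X0 q0 z0 hi0 zE XdetY hq (k := k)).
rewrite Xdot.
apply: (le_trans hk).
apply: le_trans (_ : m%:R * (6 * D ^+ 2 * ellipsoid_dot a c G G / (N G ^+ 2 * I)) <= z).
  by rewrite ler_pM2l.
rewrite mulrA ler_pdivrMr ?mulr_gt0 ?exprn_gt0//.
by move: B3; clear; lra.
Qed.
End Step.

(** * Generating triples and stability under small changes of [v] *)

Definition spans (x y z : int * 'rV[int]_2) :=
  forall w, exists i j k : int, w = lincomb i j k x y z.

(** As [sg * sg = 1], [f] is recovered as [sg] times the new vector minus [s h + i g]. *)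
Lemma spans_step (s i sg : int) (f g h : int * 'rV[int]_2) : `|sg| = 1 ->
  spans f g h -> spans g h (lincomb s i sg h g f).
Proof.
move=> sg1 sp w; have [x [y [z ->]]] := sp w.
have sg2 : sg * sg = 1 by move: sg1; case: (lerP 0 sg) => ?; lia.
exists (y - x * sg * i), (z - x * sg * s), (x * sg); rewrite /lincomb/=.
congr (_, _).
  have -> : x * f.1 = x * (sg * sg) * f.1 by rewrite sg2 mulr1.
  by ring.
apply/rowP => j; rewrite !mxE.
have -> : x * f.2 0 j = x * (sg * sg) * f.2 0 j by rewrite sg2 mulr1.
by ring.
Qed.

Lemma int_slab_eq0 (k h b : int) : 0 <= h -> h < b -> 0 < h + k * b ->
  h + k * b < b -> k = 0.
Proof.
move=> h0 hb h1 h2; have [hk|[hk|//]] : k <= -1 \/ 1 <= k \/ k = 0 by lia.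
  by exfalso; nia.
by exfalso; nia.
Qed.

Section RobustStep.
Context {R : realType}.
Implicit Types (u v w c : 'rV[R]_2) (f g h b x : int * 'rV[int]_2).

Definition near_point c (P : 'rV[R]_2 -> Prop) :=
  exists2 r : R, 0 < r & forall v, `|v - c| <= r -> P v.

Definition lip (F : 'rV[R]_2 -> R) :=
  exists L : R, forall v w, `|F v - F w| <= L * `|v - w|.

Lemma near_point_lt (F G : 'rV[R]_2 -> R) c : lip F -> lip G ->
  F c < G c -> near_point c (fun v => F v < G v).
Proof.
move=> [L hL] [L' hL'] FG; set e := G c - F c.
have e0 : 0 < e by rewrite subr_gt0.
(* [lip] does not ask for a nonnegative constant, hence the absolute values; the [1] keeps the
   denominator positive. *)
have LL : 0 < `|L| + `|L'| + 1 by rewrite ltr_wpDl.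
exists (e / 2 / (`|L| + `|L'| + 1)) => [|v]; first by rewrite !divr_gt0.
rewrite ler_pdivlMr// mulrC => hv.
have hF : `|F v - F c| <= `|L| * `|v - c|.
  by apply: (le_trans (hL _ _)); rewrite ler_wpM2r// ler_norm.
have hG : `|G v - G c| <= `|L'| * `|v - c|.
  by apply: (le_trans (hL' _ _)); rewrite ler_wpM2r// ler_norm.
have := ler_norm (F v - F c); have := ler_norm (- (G v - G c)).
rewrite normrN; have : 0 <= `|v - c| by [].
by move: hv hF hG e0; rewrite /e; clear; lra.
Qed.

Lemma lip_cst (k : R) : lip (fun=> k).
Proof. by exists 0 => v w; rewrite subrr normr0 mul0r. Qed.

Lemma lipM (k : R) F : lip F -> lip (fun v => k * F v).
Proof.
move=> [L hL]; exists (`|k| * L) => v w.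
by rewrite -mulrBr normrM -mulrA ler_wpM2l.
Qed.

Lemma disp_sub v w x : disp v x - disp w x = x.1%:~R *: (v - w).
Proof. by apply: row2P; rewrite !mxE; ring. Qed.

Lemma lip_det2_disp u x :
  lip (fun v => det2 u (disp v x)) /\ lip (fun v => det2 (disp v x) u).
Proof.
have key (F : 'rV[R]_2 -> R) : (forall v w, F v - F w =
    x.1%:~R * det2 u (v - w)) \/ (forall v w, F v - F w = x.1%:~R * det2 (v - w) u) -> lip F.
  move=> H; exists (`|x.1%:~R| * (`|u 0 0| + `|u 0 1|)) => v w.
  have -> : `|F v - F w| = `|x.1%:~R| * `|det2 u (v - w)|.
    case: H => ->; first by rewrite normrM.
    by rewrite -normrN -mulrN normrM; congr (_ * `|_|); rewrite /det2; ring.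
  rewrite -mulrA ler_wpM2l//; set y := v - w; rewrite /det2.
  apply: (le_trans (ler_normB _ _)); rewrite !normrM mulrDl.
  by rewrite lerD// ler_wpM2l// coord_le_norm.
split; apply: key; [left|right] => v w.
  by rewrite /det2 /disp !mxE; ring.
by rewrite /det2 /disp !mxE; ring.
Qed.

Variables (N : 'rV[R]_2 -> R) (hN : is_norm N).

Lemma lip_norm_disp x : lip (fun v => N (disp v x)).
Proof.
have [K K0 NK] := norm_le_sup hN.
exists (`|x.1%:~R| * K) => v w; apply: (le_trans (norm_dist hN _ _)).
by rewrite disp_sub normZ// -mulrA ler_wpM2l.
Qed.

(* In the slab [0 < x.1 < b.1], the line through [b] and [h] contains only [h]
   and [b - h]; the latter is compared with [h] through the next step. *)
Lemma near_point_shortest (g h b : int * 'rV[int]_2) (gap : R) :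
  spans g h b -> 0 < h.1 -> h.1 < b.1 ->
  let X := disp (center b) h in let Y := disp (center b) g in
  X != 0 -> 0 < gap ->
  (forall x y : int, x != 0 -> N X + gap <= N (x%:~R *: Y + y%:~R *: X)) ->
  near_point (center b) (fun v => forall x, 0 < x.1 -> x.1 < b.1 ->
    x <> (b.1 - h.1, b.2 - h.2) -> N (disp v h) <= N (disp v x)).
Proof.
move=> sp h0 hb X Y X0 gap0 hgap.
have [K K0 NK] := norm_le_sup hN; have NX0 := norm_gt0 hN X0.
have b0 : 0 < b.1 by exact: lt_trans hb.
have bR0 : 0 < b.1%:~R :> R by rewrite ltr0z.
(* Both norms move by at most [e / 2] inside the box, so a margin [e] at the centre is enough. Off
   the line of [X] it comes from [gap], on that line from a coefficient of absolute value at least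
   [2]. *)
pose e := Num.min gap (N X); have e0 : 0 < e by rewrite lt_min gap0.
exists (e / (2 * b.1%:~R * K)) => [|v hv x x0 xb xbh].
  by rewrite divr_gt0// !mulr_gt0.
have close (y : int * 'rV[int]_2) : 0 < y.1 -> y.1 < b.1 ->
    `|N (disp v y) - N (disp (center b) y)| <= e / 2.
  move=> y0 yb; apply: (le_trans (norm_dist hN _ _)).
  rewrite disp_sub normZ// gtr0_norm ?ltr0z//.
  have h1 : N (v - center b) <= e / (2 * b.1%:~R).
    apply: (le_trans (NK _)); rewrite mulrC -ler_pdivlMr//.
    by apply: (le_trans hv); rewrite invfM mulrA.
  have h2 : y.1%:~R * N (v - center b) <= b.1%:~R * N (v - center b).
    by rewrite ler_wpM2r ?norm_ge0// ler_int ltW.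
  apply: (le_trans h2); rewrite -ler_pdivlMl//.
  by apply: (le_trans h1); rewrite le_eqVlt; apply/orP; left; apply/eqP; field; rewrite gt_eqF.
have [->//|xh] := eqVneq x h.
suff far : N X + e <= N (disp (center b) x).
  have := close h h0 hb; have := close x x0 xb; rewrite -/X.
  by rewrite !ler_norml => /andP[h1 h2] /andP[h3 h4]; move: far h1 h4; clear; lra.
have [i [j [k xE]]] := sp x.
have dx : disp (center b) x = i%:~R *: Y + j%:~R *: X.
  by rewrite xE disp_lincomb disp_center ?gt_eqF// scaler0 addr0.
rewrite dx; have [i0|i0] := eqVneq i 0; last first.
  apply: le_trans (hgap _ _ i0); by rewrite lerD2l ge_min lexx.
rewrite i0 scale0r add0r normZ//.
suff j2 : 2 <= `|j|.
  have {}j2 : 2 <= `|j%:~R| :> R by rewrite -intr_norm (ler_int R 2).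
  have eX : e <= N X by rewrite ge_min lexx orbT.
  apply: le_trans (_ : 2 * N X <= _); last by rewrite ler_pM2r.
  by move: eX; clear; lra.
move: xE x0 xb xh xbh; rewrite i0 /lincomb; case: x {dx close} => x1 x2 [/= -> ->].
rewrite mul0r add0r scale0r add0r => x0 xb xh xbh.
have [//|jlt] := lerP 2 `|j|.
have [jE|[jE|jE]] : j = 0 \/ j = 1 \/ j = -1 by lia.
- exfalso; move: x0 xb; rewrite jE mul0r => x0 xb.
  have k0 := int_slab_eq0 (lexx 0) b0 x0 xb.
  by move: x0; rewrite k0 mul0r addr0 ltxx.
- exfalso; move: x0 xb xh; rewrite jE mul1r scale1r => x0 xb.
  rewrite (int_slab_eq0 (ltW h0) hb x0 xb) mul0r scale0r !addr0.
  by case: (h) => ? ?; rewrite eqxx.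
exfalso; move: x0 xb xbh; rewrite jE mulN1r scaleN1r => x0 xb.
have k1 : k - 1 = 0.
  by apply: (@int_slab_eq0 _ (b.1 - h.1) b.1); move: x0 xb hb h0; clear; lia.
have -> : k = 1 by move: k1; lia.
by rewrite mul1r scale1r addrC [- h.2 + _]addrC.
Qed.

End RobustStep.

(** * Iteration of the step, with residues and branching *)

Lemma eqz_mod_lincomb (m : int) (a a' b b' c c' x x' y y' z z' : int) :
  (a = a' %[mod m])%Z -> (b = b' %[mod m])%Z -> (c = c' %[mod m])%Z ->
  (x = x' %[mod m])%Z -> (y = y' %[mod m])%Z -> (z = z' %[mod m])%Z ->
  (a * x + b * y + c * z = a' * x' + b' * y' + c' * z' %[mod m])%Z.
Proof.
move=> /eqP ha /eqP hb /eqP hc /eqP hx /eqP hy /eqP hz; apply/eqP.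
move: ha hb hc hx hy hz; rewrite !eqz_mod_dvd => ha hb hc hx hy hz.
have -> : a * x + b * y + c * z - (a' * x' + b' * y' + c' * z') =
  ((a - a') * x + a' * (x - x')) + ((b - b') * y + b' * (y - y')) +
  ((c - c') * z + c' * (z - z')) by ring.
by do !apply: rpredD; first [exact: dvdz_mulr | exact: dvdz_mull].
Qed.

Lemma subSz1 (n : nat) : n.+1%:Z - 1 = n%:Z. Proof. by lia. Qed.
Lemma subSz2 (n : nat) : n.+1%:Z - 2 = n%:Z - 1. Proof. by lia. Qed.
Lemma subSz3 (n : nat) : n.+1%:Z - 3 = n%:Z - 2. Proof. by lia. Qed.

Section Iteration.
Context {R : realType}.
Implicit Types (v : 'rV[R]_2) (f g h b x : int * 'rV[int]_2).
Variables (N : 'rV[R]_2 -> R) (hN : is_norm N).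
Variables (a c D : R) (hE : ellipsoid_params N a c D).

(** The determinant condition says that the displacements of [f] and [g] span a lattice of covolume
    [1 / h.1]. In the iteration [kap] is the alternating sign bringing the displacement of [g] into
    the fixed cone. *)
Definition frame (e1 e2 : 'rV[R]_2) (kap : R) f g h :=
  [/\ 0 <= g.1 < h.1,
      (h.1%:~R * det2 (disp (center h) g) (disp (center h) f)) ^+ 2 = 1 :> R,
      in_cone e1 e2 (kap *: disp (center h) g) & spans f g h].

(** The vector [b - h], exempt from the last condition, is covered by the fourth one at the next
    stage, where [h] and [b] take the places of [g] and [h]. *)
Definition admissible (lo hi : R) (e1 e2 : 'rV[R]_2) (kap : R) g h b v :=
  [/\ lo <= Num.sqrt b.1%:~R * N (disp v h) <= hi,
      in_cone e1 e2 (kap *: disp v h),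
      N (disp v h) < N (disp v g), N (disp v g) <= N (disp v h - disp v g) &
      forall x, 0 < x.1 -> x.1 < b.1 ->
        x <> (b.1 - h.1, b.2 - h.2) -> N (disp v h) <= N (disp v x)].

Lemma disp_subr v g h :
  disp v h - disp v g = disp v (h.1 - g.1, h.2 - g.2).
Proof. by apply: row2P; rewrite !mxE/= !rmorphB/=; ring. Qed.

(** The strict inequalities obtained at [center b] persist on boxes around it; the smallest of these
    boxes serves for all. *)
Lemma step_frame (lo hi : R) (e1 e2 : 'rV[R]_2) (kap : R) (m : nat)
    f g h (r : R) (K s0 i0 sg : int) :
  0 < lo < hi -> (4 * D ^+ 2 - 1) * hi ^+ 4 < 4 * a * c ->
  (0 < m)%N -> 0 < r -> `|sg| = 1 -> frame e1 e2 kap f g h ->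
  exists b r', [/\ frame e1 e2 (- kap) g h b,
    (b.1 = s0 * h.1 + i0 * g.1 + sg * f.1 %[mod m%:Z])%Z,
    K < b.1, 0 < r' & forall v, `|v - center b| <= r' ->
      `|v - center h| <= r /\ admissible lo hi e1 e2 (- kap) g h b v].
Proof.
move=> lohi hiM m0 r0 sg1 [/andP[g0 gh] hdet hcone sp].
have [k k0 Nk] := norm_ge_sup hN.
(* [k] converts the bound on [N (center b - center h)] into a sup distance below [r / 2]; the other
   half is left for [v - center b]. *)
have kr0 : 0 < k * (r / 2) by rewrite mulr_gt0// divr_gt0.
have [s [i]] := step_geometry hN hE K%:~R s0 i0 lohi hiM m0 g0 gh hdet hcone kr0 sg1.
set b := lincomb s i sg h g f; cbv zeta.
set X := disp (center b) h; set Y := disp (center b) g.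
move=> [[ss0 ii0] [[Kb hb br tau cone] [XY YX XdetY [gap gap0 hgap]]]].
have h0 : 0 < h.1 by exact: le_lt_trans gh.
have X0 : X != 0.
  apply/eqP => X0; move: XdetY; rewrite X0 /det2 !mxE => /eqP.
  by rewrite !mul0r subrr mulr0 expr0n eq_sym oner_eq0.
have sp' : spans g h b by exact: spans_step.
have dE := lip_norm_disp hN.
have [r1 r10 H1] := near_point_shortest hN sp' h0 hb X0 gap0 hgap.
case/andP: tau => tau1 tau2; case: cone => cone1 cone2.
have [r2 r20 H2] := near_point_lt (lip_cst lo) (lipM (Num.sqrt b.1%:~R) (dE h)) tau1.
have [r3 r30 H3] := near_point_lt (lipM (Num.sqrt b.1%:~R) (dE h)) (lip_cst hi) tau2.
have [r4 r40 H4] := near_point_lt (dE h) (dE g) XY.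
have [r5 r50 H5] : near_point (center b) (fun v => N (disp v g) < N (disp v h - disp v g)).
  have [r' r'0 H] := near_point_lt (dE g) (dE (h.1 - g.1, h.2 - g.2)) (c := center b)
    (eq_ind _ (fun u => N Y < N u) YX _ (disp_subr _ _ _)).
  by exists r' => // v /H; rewrite disp_subr.
have [r6 r60 H6] : near_point (center b) (fun v => 0 < - kap * det2 e1 (disp v h)).
  apply: (near_point_lt (lip_cst 0)); first exact: (lipM _ (lip_det2_disp _ _).1).
  by rewrite -det2Zr.
have [r7 r70 H7] : near_point (center b) (fun v => 0 < - kap * det2 (disp v h) e2).
  apply: (near_point_lt (lip_cst 0)); first exact: (lipM _ (lip_det2_disp _ _).2).
  by rewrite -det2Zl.
exists b, (Num.min (r / 2) (Num.min r1 (Num.min r2 (Num.min r3 (Num.min r4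
  (Num.min r5 (Num.min r6 r7))))))); split.
- by split=> //; rewrite hb ltW.
- exact: eqz_mod_lincomb.
- by rewrite -(ltr_int R).
- by rewrite !lt_min r10 r20 r30 r40 r50 r60 r70 divr_gt0.
move=> v; rewrite !le_min.
move=> /and5P[vr /H1 ? /H2 v2 /H3 v3 /and4P[/H4 ? /H5 v5 /H6 v6 /H7 v7]]; split.
  have := Nk (center b - center h); have := ler_normD (v - center b) (center b - center h).
  rewrite addrA subrK => h1 h2.
  have : `|center b - center h| < r / 2 by rewrite -(ltr_pM2l k0); apply: le_lt_trans br.
  by move: vr h1; clear; lra.
split=> //; first by rewrite !ltW.
  by split; rewrite ?det2Zr ?det2Zl.
exact: ltW.
Qed.

(* Three consecutive approximations [f], [g], [h], and the radius of the box
   around [center h] in which [v] is sought. *)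
Record state := State {
  st_f : int * 'rV[int]_2; st_g : int * 'rV[int]_2; st_h : int * 'rV[int]_2;
  st_r : R }.

Variables (lo hi : nat -> R) (e1 e2 : 'rV[R]_2) (m : nat) (z : int -> int).
Hypothesis lohi : forall n, 0 < lo n < hi n.
Hypothesis hiM : forall n, (4 * D ^+ 2 - 1) * hi n ^+ 4 < 4 * a * c.
Hypothesis m0 : (0 < m)%N.
Hypothesis hz : residue_sequence m z.

(** At [n = 0] the residues are [z 0 = 1], [z (-1) = 0] and [z (-2) = 0], those of an initial triple
    with first coordinates [1], [0], [0]. *)
Definition state_inv (n : nat) (st : state) :=
  [/\ frame e1 e2 ((-1) ^+ n) (st_f st) (st_g st) (st_h st), 0 < st_r st,
      ((st_h st).1 = z n%:Z %[mod m%:Z])%Z,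
      ((st_g st).1 = z (n%:Z - 1) %[mod m%:Z])%Z &
      ((st_f st).1 = z (n%:Z - 2) %[mod m%:Z])%Z].

(** The factor [n.+1] sends the ratios of consecutive denominators to infinity, which later defeats
    bad approximability. *)
Definition state_step (n : nat) (st st' : state) :=
  [/\ state_inv n.+1 st', st_f st' = st_g st, st_g st' = st_h st,
      n.+1%:Z * (st_h st).1 <= (st_h st').1 &
      forall v, `|v - center (st_h st')| <= st_r st' ->
        `|v - center (st_h st)| <= st_r st /\
        admissible (lo n) (hi n) e1 e2 ((-1) ^+ n.+1)
          (st_g st) (st_h st) (st_h st') v].

Lemma state_step_exists n st (K : int) : state_inv n st ->
  exists2 st', state_step n st st' & K < (st_h st').1.
Proof.
case: st => f g h r [/= fr r0 rh rg rf].
have [s0 [i0 [sg sg1 zE]]] : exists s0 i0, exists2 sg : int, `|sg| = 1 &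
    (z n.+1%:Z = s0 * z n%:Z + i0 * z (n%:Z - 1) + sg * z (n%:Z - 2) %[mod m%:Z])%Z.
  have [_ _ _ /(_ n.+1%:Z isT)[_ [s0 [i0]]]] := hz.
  rewrite subSz1 subSz2 subSz3.
  by case=> zE; exists s0, i0; [exists 1; rewrite ?mul1r|exists (-1); rewrite ?mulN1r].
have [b [r' [fr' bE Kb r'0 hv]]] :=
  step_frame (Num.max K (n.+1%:Z * h.1)) s0 i0 (lohi n) (hiM n) m0 r0 sg1 fr.
rewrite gt_max in Kb; case/andP: Kb => Kb hb.
exists (State g h b r') => //; split=> //=.
- rewrite /state_inv/= exprS mulN1r; split=> //.
  + rewrite bE zE; exact: eqz_mod_lincomb.
  + by rewrite subSz1.
- exact: ltW.
by rewrite exprS mulN1r.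
Qed.

Variable st0 : state.
Hypothesis inv0 : state_inv 0 st0.

(** Each state gets two successors, the second with a larger denominator than the first, and the bit
    [w n] selects one. By induction the denominators determine the states and the bits. *)
Lemma branching_exists : exists F : (nat -> bool) -> nat -> state,
  [/\ forall w, F w 0 = st0, forall w n, state_step n (F w n) (F w n.+1) &
    forall w w', (forall n, (st_h (F w n)).1 = (st_h (F w' n)).1) -> w = w'].
Proof.
have H n st : exists p : state * state, state_inv n st ->
    [/\ state_step n st p.1, state_step n st p.2 & (st_h p.1).1 < (st_h p.2).1].
  (* Outside the invariant [(st, st)] is a default value that makes the choice function total. *)
  have [i|] := pselect (state_inv n st); last by exists (st, st).
  have [p1 h1 _] := state_step_exists 0 i.
  have [p2 h2 h12] := state_step_exists (st_h p1).1 i.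
  by exists (p1, p2).
have {H} H (nst : nat * state) := H nst.1 nst.2.
have [S hS] := choice H.
pose next n st (b : bool) := if b then (S (n, st)).1 else (S (n, st)).2.
pose fix F (w : nat -> bool) n := if n is n'.+1 then next n' (F w n') (w n') else st0.
have Finv w n : state_inv n (F w n).
  elim: n => [//|n IH] /=; have [s1 s2 _] := hS (n, F w n) IH.
  by rewrite /next; case: (w n); [case: s1|case: s2].
exists F; split=> // [w n|w w' hw].
  rewrite /= /next; have [s1 s2 _] := hS (n, F w n) (Finv w n).
  by case: (w n).
have FE n : F w n = F w' n /\ (forall k, (k < n)%N -> w k = w' k).
  elim: n => [//|n [IH1 IH2]].
  have wn : w n = w' n.
    have [_ _ lt12] := hS (n, F w n) (Finv w n).
    have := hw n.+1; rewrite /= -IH1 /next.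
    by case: (w n); case: (w' n) => // E; move: lt12; rewrite E ltxx.
  split; first by rewrite /= IH1 wn.
  by move=> k; rewrite ltnS leq_eqVlt => /predU1P[->|/IH2].
by apply/funext => n; have [_] := FE n.+1; apply.
Qed.

End Iteration.

(** * The common point of nested boxes and its best approximations *)

Section Limit.
Context {R : realType}.
Implicit Types (v w : 'rV[R]_2) (x : int * 'rV[int]_2).

(** In each coordinate the boxes are intervals, and the supremum of the left endpoints lies in all
    of them. *)
Lemma nested_boxes (ctr : nat -> 'rV[R]_2) (r : nat -> R) :
  (forall n, 0 < r n) ->
  (forall n w, `|w - ctr n.+1| <= r n.+1 -> `|w - ctr n| <= r n) ->
  exists v, forall n, `|v - ctr n| <= r n.
Proof.
move=> r0 nest.
have nestD n k w : `|w - ctr (n + k)%N| <= r (n + k)%N -> `|w - ctr n| <= r n.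
  elim: k => [|k IH]; first by rewrite addn0.
  by rewrite addnS => /nest.
have corner n k j (s : R) : `|s| <= 1 ->
    `|ctr (n + k)%N 0 j + s * r (n + k)%N - ctr n 0 j| <= r n.
  move=> s1; set l := (n + k)%N; pose w := ctr l + const_mx (s * r l).
  have hw : `|w - ctr n| <= r n.
    apply: (nestD n k); rewrite /w [_ + const_mx _]addrC addrK.
    by apply: norm_le_coord; rewrite mxE normrM (gtr0_norm (r0 l)) ler_piMl// ltW.
  by apply: le_trans hw; have := coord_le_norm (w - ctr n) j; rewrite /w !mxE.
(* The centre of index [n + k] lies in both boxes [n] and [k], between the left end of one and the
   right end of the other. *)
have lowup n k j : ctr n 0 j - r n <= ctr k 0 j + r k.
  have := corner n k j 0; have := corner k n j 0; rewrite normr0 mul0r addr0 addnC.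
  move=> /(_ ler01); rewrite ler_norml => /andP[_ h1].
  move=> /(_ ler01); rewrite ler_norml => /andP[h2 _].
  by move: h1 h2; lra.
pose A j := [set ctr n 0 j - r n | n in [set: nat]].
have A0 j : A j !=set0 by exists (ctr 0%N 0 j - r 0%N), 0%N.
have ubA j k : ubound (A j) (ctr k 0 j + r k) by move=> _ [n _ <-].
have supA j : has_sup (A j) by split => //; exists (ctr 0%N 0 j + r 0%N).
exists (\row_j sup (A j)) => n; apply: norm_le_coord; rewrite !mxE ler_norml.
  have : sup (A 0) <= ctr n 0 0 + r n by exact: ge_sup.
  have : ctr n 0 0 - r n <= sup (A 0) by apply: ub_le_sup; [case: (supA 0)|exists n].
  by move=> ? ?; apply/andP; split; lra.
have : sup (A 1) <= ctr n 0 1 + r n by exact: ge_sup.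
have : ctr n 0 1 - r n <= sup (A 1) by apply: ub_le_sup; [case: (supA 1)|exists n].
by move=> ? ?; apply/andP; split; lra.
Qed.

Variables (N : 'rV[R]_2 -> R) (hN : is_norm N).

Lemma disp_nat v (k : nat) p : disp v (k%:Z, p) = k%:R *: v - int_vec p.
Proof. by rewrite /disp/= -pmulrn. Qed.

Lemma lattice_dist_le v (k : nat) p :
  lattice_dist N (k%:R *: v) <= N (disp v (k%:Z, p)).
Proof.
rewrite disp_nat; apply: ge_inf; last by exists p.
by exists 0 => _ [p' _ <-]; exact: norm_ge0.
Qed.

Lemma le_lattice_dist v (k : nat) (x : R) :
  (forall p, x <= N (disp v (k%:Z, p))) -> x <= lattice_dist N (k%:R *: v).
Proof.
move=> hx; apply: lb_le_inf; first by exists (N (k%:R *: v - int_vec 0)), 0.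
by move=> _ [p _ <-]; rewrite -disp_nat.
Qed.

Lemma lattice_dist_ge0 v (k : nat) : 0 <= lattice_dist N (k%:R *: v).
Proof. by apply: le_lattice_dist => p; exact: norm_ge0. Qed.

Section Minimal.
Variables (v : 'rV[R]_2) (b : nat -> int * 'rV[int]_2).
Hypothesis b0 : (b 0).1 = 1.
Hypothesis blt : forall n, (b n).1 < (b n.+1).1.
Hypothesis decr : forall n, N (disp v (b n.+1)) < N (disp v (b n)).
Hypothesis shortest : forall n x, 0 < x.1 -> x.1 < (b n.+1).1 ->
  N (disp v (b n)) <= N (disp v x).

Let q n := `|(b n).1|%N.
Let p n := (b n).2.

Lemma minimal_gt0 n : 0 < (b n).1.
Proof. by elim: n => [|n IH]; [rewrite b0|exact: lt_trans (blt n)]. Qed.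

Lemma minimal_natE n : (q n)%:Z = (b n).1.
Proof. by rewrite /q gez0_abs// ltW// minimal_gt0. Qed.

Lemma minimal_dispE n : (q n)%:R *: v - int_vec (p n) = disp v (b n).
Proof. by rewrite -disp_nat minimal_natE -surjective_pairing. Qed.

Lemma minimal_dist n : lattice_dist N ((q n)%:R *: v) = N (disp v (b n)).
Proof.
apply/eqP; rewrite eq_le; apply/andP; split.
  by apply: le_trans (lattice_dist_le v (q n) (p n)) _; rewrite disp_nat minimal_dispE.
apply: le_lattice_dist => p'; apply: shortest => /=.
  by rewrite minimal_natE minimal_gt0.
by rewrite minimal_natE.
Qed.

(** [shortest] excludes any improvement by a denominator below [q n.+1], and [decr] shows that
    [q n.+1] is one. *)
Lemma minimal_best_approximations : best_approximations N v q p.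
Proof.
have qlt n : (q n < q n.+1)%N by rewrite -ltz_nat !minimal_natE.
split=> // [|n|n].
- by rewrite /q b0.
- split=> [|j [j0]]; first by split; [exact: leq_ltn_trans (qlt n)|rewrite !minimal_dist].
  rewrite minimal_dist => jlt; rewrite leqNgt; apply/negP => jq.
  suff : N (disp v (b n)) <= lattice_dist N (j%:R *: v) by rewrite leNgt jlt.
  apply: le_lattice_dist => p'; apply: shortest => /=; first by rewrite ltz_nat.
  by rewrite -minimal_natE ltz_nat.
by rewrite minimal_dispE minimal_dist.
Qed.

Lemma minimal_unbounded (K : nat) : exists n, (K < q n)%N.
Proof.
suff H n : (n < q n)%N by exists K.
elim: n => [|n IH]; first by rewrite /q b0.
by apply: leq_ltn_trans IH _; rewrite -ltz_nat !minimal_natE.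
Qed.

(** If [v] had a common denominator [k], a triple with first coordinate [k] would have displacement
    [0], and [shortest] would force [N (disp v (b n)) <= 0] once [q n > k]. Strict decrease forbids
    this. *)
Lemma minimal_irrational : ~ rational_point v.
Proof.
move=> [rv vE]; pose k : int := denq (rv 0 0) * denq (rv 0 1).
have k0 : 0 < k by rewrite mulr_gt0.
have [n kn] := minimal_unbounded `|k|%N.
pose pt : 'rV[int]_2 := \row_j (if j == 0 then numq (rv 0 0) * denq (rv 0 1)
                               else numq (rv 0 1) * denq (rv 0 0)).
have dk : disp v (k, pt) = 0.
  have E j : v 0 j = (numq (rv 0 j))%:~R / (denq (rv 0 j))%:~R by rewrite vE mxE.
  have D j : (denq (rv 0 j))%:~R != 0 :> R by rewrite intr_eq0 denq_neq0.
  by apply: row2P; rewrite !mxE/= E !rmorphM/=; field; exact: D.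
have : N (disp v (b n)) <= 0.
  rewrite -(norm0 hN) -dk; apply: shortest => //=.
  by apply: lt_trans (blt n); rewrite -minimal_natE -(gtz0_abs k0) ltz_nat.
have := decr n; have := norm_ge0 hN (disp v (b n.+1)) => h1 h2 h3.
by have := lt_le_trans (le_lt_trans h1 h2) h3; rewrite ltxx.
Qed.

(** Taking [T = q n] bounds the infimum [e] by the square root of [q n] times [N (disp v (b n))].
    Squaring and using [n.+1 * q n <= q n.+1] gives [e ^+ 2 * n.+1 <= M ^+ 2] for every [n]. *)
Lemma minimal_not_badly_approximable (M : R) :
  (forall n, n.+1%:Z * (b n).1 <= (b n.+1).1) ->
  (forall n, Num.sqrt (b n.+1).1%:~R * N (disp v (b n)) <= M) ->
  ~ badly_approximable N v.
Proof.
move=> growth hM; rewrite /badly_approximable; set S := [set _ | _ in _] => infS.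
set e := inf S in infS.
have inner_ge0 (T : R) : 1 <= T -> 0 <= inf [set lattice_dist N (q0%:R *: v) |
    q0 in [set q0 : nat | (0 < q0)%N /\ q0%:R <= T]].
  move=> T1; apply: lb_le_inf; first by exists (lattice_dist N (1%:R *: v)), 1%N.
  by move=> _ [k _ <-]; exact: lattice_dist_ge0.
have lbS : lbound S 0.
  by move=> _ [T T1 <-]; rewrite mulr_ge0 ?sqrtr_ge0 ?inner_ge0.
have M0 : 0 <= M by apply: le_trans (hM 0%N); rewrite mulr_ge0 ?sqrtr_ge0 ?norm_ge0.
have small n : e ^+ 2 * n.+1%:R <= M ^+ 2.
  have qn0 : 0 < (q n)%:R :> R by rewrite ltr0n -ltz_nat minimal_natE minimal_gt0.
  have le1 : e <= Num.sqrt (q n)%:R * N (disp v (b n)).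
    apply: (@le_trans _ _ (Num.sqrt (q n)%:R * inf [set lattice_dist N (q0%:R *: v) |
      q0 in [set q0 : nat | (0 < q0)%N /\ q0%:R <= (q n)%:R :> R]])).
      apply: ge_inf; first by exists 0.
      exists (q n)%:R => //=; rewrite (ler_nat R 1).
      by rewrite -ltz_nat minimal_natE minimal_gt0.
    rewrite ler_wpM2l ?sqrtr_ge0// -minimal_dist; apply: ge_inf.
      by exists 0 => _ [k _ <-]; exact: lattice_dist_ge0.
    by exists (q n) => //=; split => //; rewrite -ltz_nat minimal_natE minimal_gt0.
  have N0 := norm_ge0 hN (disp v (b n)).
  have le2 : e ^+ 2 <= (q n)%:R * N (disp v (b n)) ^+ 2.
    rewrite -[X in _ <= X * _]sqr_sqrtr ?(ltW qn0)// -exprMn.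
    by rewrite ler_sqr ?nnegrE ?(ltW infS)// mulr_ge0 ?sqrtr_ge0.
  have le3 : (b n.+1).1%:~R * N (disp v (b n)) ^+ 2 <= M ^+ 2.
    have B0 : 0 <= (b n.+1).1%:~R :> R by rewrite ler0z ltW// minimal_gt0.
    rewrite -[X in X * _](sqr_sqrtr B0) -exprMn ler_sqr ?nnegrE//.
    by rewrite mulr_ge0 ?sqrtr_ge0.
  apply: le_trans le3; apply: le_trans (ler_wpM2r (ler0n _ _) le2) _.
  rewrite mulrAC ler_wpM2r ?sqr_ge0// mulrC.
  have := growth n; rewrite -(ler_int R) rmorphM/= -[(b n).1]minimal_natE.
  by rewrite -!pmulrn.
have e20 : 0 < e ^+ 2 by rewrite exprn_gt0.
pose n := Num.truncn (M ^+ 2 / e ^+ 2).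
have : M ^+ 2 / e ^+ 2 < n.+1%:R by exact: truncnS_gt.
by rewrite ltr_pdivrMr// mulrC ltNge small.
Qed.

End Minimal.
End Limit.

(** * Cones, angular sectors and quadrants *)

Section Cone.
Context {R : realType}.
Implicit Types (u w : 'rV[R]_2) (theta delta beta : R).

Definition unit_vec beta : 'rV[R]_2 := row2 (cos beta) (sin beta).

Lemma OmegaZ theta delta (k : R) u :
  Omega theta delta u -> Omega theta delta (k *: u).
Proof.
move=> [r [beta [h x y]]]; exists (k * r), beta.
by rewrite !mxE x y !mulrA.
Qed.

(** By the intermediate value theorem [det2 (unit_vec b) u] vanishes for some [b] between [b1] and
    [b2]; then [u] is a multiple of [unit_vec b], the factor being their inner product. *)
Lemma in_cone_Omega theta delta b1 b2 u :
  theta - delta <= b1 -> b1 <= b2 -> b2 <= theta + delta ->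
  in_cone (unit_vec b1) (unit_vec b2) u -> Omega theta delta u.
Proof.
move=> h1 h12 h2 [L1 L2].
pose F (b : R) := cos b * u 0 1 - sin b * u 0 0.
have cF : continuous F.
  by move=> b; apply: cvgB; apply: cvgMr_tmp; [exact: continuous_cos|exact: continuous_sin].
have F1 : 0 < F b1 by move: L1; rewrite /F /det2 row20 row21; lra.
have F2 : F b2 < 0 by move: L2; rewrite /F /det2 row20 row21; lra.
have [|b] := IVT (v := 0) h12 (continuous_subspaceT cF).
  by rewrite ge_min le_max (ltW F1) (ltW F2) orbT.
rewrite in_itv/= => /andP[b1b bb2] Fb.
exists (u 0 0 * cos b + u 0 1 * sin b), b; split.
- by rewrite (le_trans h1 b1b) (le_trans bb2 h2).
- have := cos2Dsin2 b; move: Fb; rewrite /F.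
  have -> : (u 0 0 * cos b + u 0 1 * sin b) * cos b =
    u 0 0 * (cos b ^+ 2 + sin b ^+ 2) + sin b * (cos b * u 0 1 - sin b * u 0 0) by ring.
  by move=> -> ->; rewrite mulr1 mulr0 addr0.
have := cos2Dsin2 b; move: Fb; rewrite /F.
have -> : (u 0 0 * cos b + u 0 1 * sin b) * sin b =
  u 0 1 * (cos b ^+ 2 + sin b ^+ 2) - cos b * (cos b * u 0 1 - sin b * u 0 0) by ring.
by move=> -> ->; rewrite mulr1 mulr0 subr0.
Qed.

Lemma det2_unit_vec b1 b2 : det2 (unit_vec b1) (unit_vec b2) = sin (b2 - b1).
Proof. by rewrite /det2 !row20 !row21 sinB; ring. Qed.

(** Cramer's rule makes a positive multiple of [u] a positive combination of the two edges, so [u]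
    inherits their signs. *)
Lemma in_cone_quadrant (s t : bool) b1 b2 u : 0 < sin (b2 - b1) ->
  quadrant s t (unit_vec b1) -> quadrant s t (unit_vec b2) ->
  in_cone (unit_vec b1) (unit_vec b2) u -> quadrant s t u.
Proof.
move=> S [c1 s1] [c2 s2] [L1 L2]; rewrite -det2_unit_vec in S.
rewrite /quadrant/=.
split; rewrite -(pmulr_rgt0 _ S).
  have -> : det2 (unit_vec b1) (unit_vec b2) * ((-1) ^+ s * u 0 0) =
    det2 u (unit_vec b2) * ((-1) ^+ s * unit_vec b1 0 0) +
    det2 (unit_vec b1) u * ((-1) ^+ s * unit_vec b2 0 0) by rewrite /det2; ring.
  by rewrite addr_gt0// mulr_gt0.
have -> : det2 (unit_vec b1) (unit_vec b2) * ((-1) ^+ t * u 0 1) =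
  det2 u (unit_vec b2) * ((-1) ^+ t * unit_vec b1 0 1) +
  det2 (unit_vec b1) u * ((-1) ^+ t * unit_vec b2 0 1) by rewrite /det2; ring.
by rewrite addr_gt0// mulr_gt0.
Qed.

(** A rational slope strictly between the tangents of [b1] and [b2] gives a primitive vector,
    completed to a unimodular pair by Bezout; [s] selects the half-plane of the cone. *)
Lemma in_cone_primitive (s : bool) b1 b2 : 0 < sin (b2 - b1) ->
  0 < (-1) ^+ s * cos b1 -> 0 < (-1) ^+ s * cos b2 ->
  exists e f : 'rV[int]_2, in_cone (unit_vec b1) (unit_vec b2) (int_vec e) /\
    e 0 0 * f 0 1 - e 0 1 * f 0 0 = 1.
Proof.
rewrite sinB => S c1 c2.
have c10 : cos b1 != 0 by apply: contra_ltN c1 => /eqP->; rewrite mulr0.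
have c20 : cos b2 != 0 by apply: contra_ltN c2 => /eqP->; rewrite mulr0.
have sgn2 : (-1) ^+ s * (-1) ^+ s = 1 :> R by rewrite -signr_addb addbb.
have cc : 0 < cos b1 * cos b2.
  have := mulr_gt0 c1 c2; rewrite mulrACA sgn2 mul1r//.
have t12 : sin b1 / cos b1 < sin b2 / cos b2.
  rewrite -subr_gt0 (_ : _ - _ = (sin b2 * cos b1 - cos b2 * sin b1) / (cos b1 * cos b2)).
    by rewrite divr_gt0.
  by field; rewrite c10 c20.
have [x] := rat_in_itvoo t12; rewrite in_itv/= => /andP[x1 x2].
have d0 : 0 < (denq x)%:~R :> R by rewrite ltr0z.
have xE : ratr x * (denq x)%:~R = (numq x)%:~R :> R.
  by rewrite /ratr divfK// gt_eqF.
have [w [y xyE]] := Bezoutz (denq x) (numq x).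
have {}xyE : w * denq x + y * numq x = 1.
  rewrite xyE; apply/eqP; rewrite -/(coprimez _ _) /coprimez.
  by have := coprime_num_den x; rewrite /coprime gcdnC.
pose sg : int := (-1) ^+ s.
have sgsg : sg * sg = 1 by rewrite /sg -signr_addb addbb.
exists (\row_j (sg * if j == 0 then denq x else numq x)),
  (\row_j (sg * if j == 0 then - y else w)); split.
  have sgE : sg%:~R = (-1) ^+ s :> R by rewrite /sg rmorphXn/= rmorphN1.
  split; rewrite /det2 !mxE/= !rmorphM/= sgE -xE.
    have -> : cos b1 * ((-1) ^+ s * (ratr x * (denq x)%:~R)) -
        sin b1 * ((-1) ^+ s * (denq x)%:~R) =
      ((-1) ^+ s * cos b1) * (denq x)%:~R * (ratr x - sin b1 / cos b1) by field.
    by rewrite mulr_gt0 ?subr_gt0// mulr_gt0.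
  have -> : (-1) ^+ s * (denq x)%:~R * sin b2 -
      (-1) ^+ s * (ratr x * (denq x)%:~R) * cos b2 =
    ((-1) ^+ s * cos b2) * (denq x)%:~R * (sin b2 / cos b2 - ratr x) by field.
  by rewrite mulr_gt0 ?subr_gt0// mulr_gt0.
rewrite !mxE/=.
have -> : sg * denq x * (sg * w) - sg * numq x * (sg * - y) =
  (sg * sg) * (w * denq x + y * numq x) by ring.
by rewrite sgsg xyE.
Qed.

Lemma ex_cone theta delta : 0 < delta ->
  exists e1 e2 : 'rV[R]_2, exists s t : bool,
    [/\ forall u, in_cone e1 e2 u -> Omega theta delta u,
        forall u, in_cone e1 e2 u -> quadrant s t u &
        exists e f : 'rV[int]_2, in_cone e1 e2 (int_vec e) /\
          e 0 0 * f 0 1 - e 0 1 * f 0 0 = 1].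
Proof.
move=> delta0.
have [b [tb [sb cb]]] : exists b, theta - delta < b < theta + delta /\
    (sin b != 0 /\ cos b != 0).
  (* If [theta] lies on an axis, a turn by [eta], smaller than [delta] and than a right angle,
     leaves the axis and stays in the sector. *)
  pose eta := Num.min (delta / 2) 2^-1.
  have eta0 : 0 < eta by rewrite lt_min divr_gt0/=.
  have etad : eta <= delta / 2 by rewrite ge_min lexx.
  have eta1 : eta <= 2^-1 by rewrite ge_min lexx orbT.
  have [h|h] := eqVneq (sin theta * cos theta) 0; last first.
    by exists theta; move: h; rewrite mulf_eq0 negb_or => /andP[]; split=> //; lra.
  exists (theta + eta); split; first by lra.
  have ceta : 0 < cos eta by rewrite cos_gt0_pihalf//; have := pihalf_ge1 R; lra.
  have seta : 0 < sin eta.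
    by rewrite sin_gt0_pi// eta0/=; have := pi_ge2 R; lra.
  have cs := cos2Dsin2 theta; rewrite sinD cosD.
  move/eqP: h; rewrite mulf_eq0 => /orP[] /eqP h; rewrite h in cs *.
    have ct : cos theta != 0.
      by apply/eqP => ct; move: cs; rewrite ct expr0n addr0 => /eqP; rewrite eq_sym oner_eq0.
    by rewrite !mul0r add0r subr0; split; rewrite mulf_neq0 // gt_eqF.
  have st : sin theta != 0.
    by apply/eqP => st; move: cs; rewrite st expr0n addr0 => /eqP; rewrite eq_sym oner_eq0.
  by rewrite !mul0r addr0 sub0r oppr_eq0; split; rewrite mulf_neq0 // gt_eqF.
have signed (x : R) : x != 0 -> 0 < (-1) ^+ (x < 0)%R * x.
  move=> x0; case: (ltrP x 0) => h.
    by rewrite expr1 mulN1r oppr_gt0.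
  by rewrite expr0 mul1r lt_def x0 h.
have local_pos (F : R -> R) : continuous F -> 0 < F b ->
    exists2 d, 0 < d & forall x, `|x - b| < d -> 0 < F x.
  move=> cF Fb; have /cvgrPdist_lt/(_ _ Fb)/nbhs_ballP[d d0 hd] := cF b.
  exists d => // x xb; have := hd x; rewrite /ball/= distrC => /(_ xb).
  by rewrite ltr_norml; lra.
have [d1 d10 hd1] := local_pos _ (fun x => cvgMl_tmp (@continuous_cos R x)) (signed _ cb).
have [d2 d20 hd2] := local_pos _ (fun x => cvgMl_tmp (@continuous_sin R x)) (signed _ sb).
(* [d1] and [d2] preserve the signs of cosine and sine, [1] keeps the opening below [pi], and the
   last bound keeps the arc in the sector. *)
pose eta := Num.min (Num.min (d1 / 2) (d2 / 2)) (Num.min 1 (theta + delta - b)).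
have eta0 : 0 < eta by rewrite !lt_min !divr_gt0// ltr01/= subr_gt0; case/andP: tb.
have [[eta1 eta2] [eta3 eta4]] : (eta <= d1 / 2 /\ eta <= d2 / 2) /\
    (eta <= 1 /\ eta <= theta + delta - b).
  by rewrite /eta !ge_min !lexx !orbT.
have S : 0 < sin (b + eta - b).
  by rewrite addrC addKr sin_gt0_pi// eta0/=; have := pi_ge2 R; lra.
exists (unit_vec b), (unit_vec (b + eta)), (cos b < 0), (sin b < 0); split.
- by move=> u; apply: in_cone_Omega; lra.
- move=> u; apply: in_cone_quadrant => //; rewrite /quadrant/= !row20 !row21.
    by rewrite !signed.
  split; [apply: hd1|apply: hd2]; rewrite addrC addKr gtr0_norm//; lra.
apply: (in_cone_primitive (s := cos b < 0)) => //; first exact: signed.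
by apply: hd1; rewrite addrC addKr gtr0_norm//; lra.
Qed.
End Cone.

(** * The cardinality of the continuum through binary sequences *)

Section Cardinality.
Context {R : realType}.

(** A real number is encoded by its Dedekind cut, read along an enumeration of the rationals. *)
Lemma real_to_bits : exists f : R -> nat -> bool, injective f.
Proof.
exists (fun r n => if unpickle n is Some x then ratr (x : rat) < r else false).
suff H (r s : R) : r < s -> (fun n => if unpickle n is Some x then ratr (x : rat) < r else false)
   <> (fun n => if unpickle n is Some x then ratr (x : rat) < s else false).
  by move=> r s E; case: (ltgtP r s) => // /H; [|move/nesym].
move=> rs /(congr1 (fun f => f _)) E.
have [x] := rat_in_itvoo rs; rewrite in_itv/= => /andP[rx xs].
have := E (pickle x); rewrite pickleK xs; apply/negP.
by rewrite -leNgt ltW.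
Qed.

(** Base 3 with digits [0] and [1] avoids the double expansions of base 2. *)
Definition ternary (w : nat -> bool) (n : nat) : R :=
  \sum_(i < n) (w i)%:R * 3 ^- i.

Lemma ternaryS w n : ternary w n.+1 = ternary w n + (w n)%:R * 3 ^- n.
Proof. by rewrite /ternary big_ord_recr. Qed.

Lemma ternary_le w n k :
  ternary w n <= ternary w (n + k) <= ternary w n + 3 / 2 * 3 ^- n - 3 / 2 * 3 ^- (n + k).
Proof.
elim: k => [|k IH]; first by rewrite addn0 addrK !lexx.
rewrite addnS ternaryS; move/andP: IH => [IH1 IH2].
have p0 : 0 < 3 ^- (n + k) :> R by rewrite invr_gt0 exprn_gt0.
have -> : 3 ^- (n + k).+1 = 3^-1 * 3 ^- (n + k) :> R by rewrite exprS invfM.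
have : 0 <= ((w (n + k)%N)%:R * 3 ^- (n + k) : R) <= 3 ^- (n + k).
  by case: (w _); rewrite ?mul1r ?mul0r ?lexx ?ltW.
by move=> /andP[? ?]; apply/andP; split; lra.
Qed.

(** At the first difference the digit contributes [3 ^- n], while the tail after it is at most half
    of that. *)
Lemma bits_to_real : exists f : (nat -> bool) -> R, injective f.
Proof.
pose A w := [set ternary w n | n in [set: nat]].
have p0 n : 0 < 3 ^- n :> R by rewrite invr_gt0 exprn_gt0.
have bound w n k : ternary w k <= ternary w n + 3 / 2 * 3 ^- n.
  case: (leqP n k) => [nk|/ltnW nk].
    have /andP[_] := ternary_le w n (k - n); rewrite subnKC// => h.
    by have := p0 k; lra.
  have /andP[h _] := ternary_le w k (n - k); rewrite subnKC// in h.
  by have := p0 n; lra.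
have lo w n : ternary w n <= sup (A w).
  apply: ub_le_sup; last by exists n.
  by exists (ternary w 0 + 3 / 2 * 3 ^- 0) => _ [k _ <-].
have hi w n : sup (A w) <= ternary w n + 3 / 2 * 3 ^- n.
  by apply: ge_sup => [|_ [k _ <-]//]; exists (ternary w 0), 0%N.
exists (fun w => sup (A w)).
have lt w w' n : ternary w n = ternary w' n -> w n -> ~~ w' n -> sup (A w') < sup (A w).
  move=> E wn w'n; apply: le_lt_trans (hi w' n.+1) _; apply: lt_le_trans (lo w n.+1).
  rewrite !ternaryS wn (negbTE w'n) mul0r mul1r E exprS invfM.
  by have := p0 n; lra.
move=> w w' E; apply/funext => n.
suff [//] : w n = w' n /\ ternary w n.+1 = ternary w' n.+1.
have key k : ternary w k = ternary w' k -> w k = w' k.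
  move=> Ek; case Ew : (w k); case Ew' : (w' k) => //.
    by have := lt w w' k Ek Ew (negbT Ew'); rewrite E ltxx.
  by have := lt w' w k (esym Ek) Ew' (negbT Ew); rewrite E ltxx.
elim: n => [|n [IH1 IH2]].
  have E0 : ternary w 0 = ternary w' 0 by rewrite /ternary !big_ord0.
  by rewrite !ternaryS E0 (key _ E0).
by rewrite !(ternaryS _ n.+1) IH2 (key _ IH2).
Qed.

(** Even positions carry the bits of the first coordinate, odd positions those of the second. *)
Lemma row2_to_real : exists f : 'rV[R]_2 -> R, injective f.
Proof.
have [f finj] := bits_to_real; have [g ginj] := real_to_bits.
exists (fun v => f (fun n => g (v 0 (if odd n then 1 else 0)) n./2)).
move=> u v /finj E.
apply: row2P; apply: ginj; apply/funext => n.
  by have := congr1 (fun w => w n.*2) E; rewrite /= odd_double doubleK.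
by have := congr1 (fun w => w n.*2.+1) E; rewrite /= odd_double/= uphalf_double.
Qed.

Lemma card_eq_real (A : set 'rV[R]_2) (h : (nat -> bool) -> 'rV[R]_2) :
  injective h -> (forall w, A (h w)) -> A #= [set: R].
Proof.
move=> hinj hA; apply: Cantor_Bernstein.
  have [f finj] := row2_to_real.
  by apply/pcard_injP; exists f => x y _ _; exact: finj.
have [g ginj] := real_to_bits.
have E : [set h (g x) | x in [set: R]] #= [set: R].
  by apply: inj_card_eq => x y _ _ /hinj/ginj.
by rewrite -(card_le_eql E); apply: subset_card_le => _ [x _ <-].
Qed.
End Cardinality.

(** * Closed conditions and the existence of a best ellipsoid norm *)

Section RealContinuity.
Context {R : realType} {T : topologicalType}.
Implicit Types f g : T -> R.

Lemma continuous_add f g : continuous f -> continuous g ->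
  continuous (fun x => f x + g x).
Proof. by move=> cf cg x; apply: cvgD; [exact: cf|exact: cg]. Qed.

Lemma continuous_mul f g : continuous f -> continuous g ->
  continuous (fun x => f x * g x).
Proof. by move=> cf cg x; apply: cvgM; [exact: cf|exact: cg]. Qed.

Lemma closed_le_continuous f g : continuous f -> continuous g ->
  closed [set x | f x <= g x].
Proof.
move=> cf cg; rewrite (_ : [set _ | _] = (fun x => g x + -1 * f x) @^-1` [set y | 0 <= y]).
  apply: closed_comp; last exact: closed_ge.
  move=> x _; apply: continuous_add; first exact: cg.
  by apply: continuous_mul; [exact: cst_continuous|exact: cf].
by apply/seteqP; split => x /=; rewrite mulN1r subr_ge0.
Qed.

End RealContinuity.

Section BestEllipsoid.
Context {R : realType}.
Variables (N : 'rV[R]_2 -> R) (hN : is_norm N).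
Implicit Types (u : 'rV[R]_2) (a c D : R).

Lemma ellipsoid_paramsP a c D : ellipsoid_params N a c D <->
  [/\ 0 < a, 0 < c, 1 <= D & forall u,
    ellipsoid_dot a c u u <= N u ^+ 2 <= D ^+ 2 * ellipsoid_dot a c u u].
Proof.
split=> [hE|[a0 c0 D1 hu]].
  by have [a0 c0 D1 _] := hE; split=> // u; exact: (ellipsoid_sqr_le hN hE).
split=> // u; have := hu u; rewrite ellipsoid_normE.
have E0 := ellipsoid_dot_ge0 u a0 c0; have EE := sqr_sqrtr E0; rewrite -{1 2}EE.
have D0 : 0 <= D by exact: le_trans D1.
by rewrite -exprMn !ler_sqr ?nnegrE ?sqrtr_ge0 ?norm_ge0 ?mulr_ge0 ?sqrtr_ge0.
Qed.

(** The fourth power of [ellipsoid_value] on admissible parameters; comparing these avoids real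
    exponents. *)
Definition ellipsoid_ratio a c D : R := (4 * a * c) / (4 * D ^+ 2 - 1).

Lemma ellipsoid_denom_gt0 D : 1 <= D -> 0 < 4 * D ^+ 2 - 1.
Proof. by move=> D1; have := exprn_ege1 2 D1; lra. Qed.

Lemma ellipsoid_ratio_gt0 a c D : ellipsoid_params N a c D ->
  0 < ellipsoid_ratio a c D.
Proof.
by move=> [a0 c0 D1 _]; rewrite divr_gt0 ?mulr_gt0// ellipsoid_denom_gt0.
Qed.

Lemma ellipsoid_value_le a c D a' c' D' :
  ellipsoid_params N a c D -> ellipsoid_params N a' c' D' ->
  ellipsoid_ratio a c D <= ellipsoid_ratio a' c' D' ->
  ellipsoid_value a c D <= ellipsoid_value a' c' D'.
Proof.
move=> /ellipsoid_ratio_gt0 h1 /ellipsoid_ratio_gt0 h2 h.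
by apply: ge0_ler_powR => //; rewrite nnegrE ltW.
Qed.

Lemma ellipsoid_params_exist : exists a c D, ellipsoid_params N a c D.
Proof.
have [k k0 kN] := norm_ge_sup hN; have [K K0 NK] := norm_le_sup hN.
(* The Euclidean square lies between the squared sup norm and its double, hence the parameter
   [k ^+ 2 / 2]; the summand [1] ensures [1 <= D]. *)
pose D := Num.sqrt (2 * K ^+ 2 / k ^+ 2 + 1).
have KK : 0 <= 2 * K ^+ 2 / k ^+ 2 by rewrite divr_ge0 ?mulr_ge0 ?exprn_ge0// ltW.
have D2 : D ^+ 2 = 2 * K ^+ 2 / k ^+ 2 + 1 by rewrite sqr_sqrtr//; lra.
have k20 : 0 < k ^+ 2 / 2 by rewrite divr_gt0// exprn_gt0.
exists (k ^+ 2 / 2), (k ^+ 2 / 2), D; apply/ellipsoid_paramsP; split => //.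
  by rewrite -[1]sqrtr1 ler_wsqrtr// lerDr.
move=> u; rewrite /ellipsoid_dot -!expr2 -mulrDr.
have u0 : u 0 0 ^+ 2 <= `|u| ^+ 2.
  by rewrite -(real_normK (num_real (u 0 0))) ler_sqr ?nnegrE// coord_le_norm.
have u1 : u 0 1 ^+ 2 <= `|u| ^+ 2.
  by rewrite -(real_normK (num_real (u 0 1))) ler_sqr ?nnegrE// coord_le_norm.
have uu : `|u| ^+ 2 <= u 0 0 ^+ 2 + u 0 1 ^+ 2.
  have h0 : 0 <= u 0 0 ^+ 2 + u 0 1 ^+ 2 by rewrite addr_ge0 ?sqr_ge0.
  rewrite -[leRHS](sqr_sqrtr h0) ler_sqr ?nnegrE ?sqrtr_ge0//.
  by apply: norm_le_coord; rewrite -sqrtr_sqr ler_wsqrtr// ?lerDl ?lerDr sqr_ge0.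
apply/andP; split.
  apply: (@le_trans _ _ (k ^+ 2 * `|u| ^+ 2)).
    have h : u 0 0 ^+ 2 + u 0 1 ^+ 2 <= 2 * `|u| ^+ 2 by lra.
    by apply: le_trans (ler_wpM2l (ltW k20) h) _; rewrite mulrA divfK.
  by rewrite -exprMn ler_sqr ?nnegrE ?norm_ge0// mulr_ge0// ltW.
apply: (@le_trans _ _ (K ^+ 2 * `|u| ^+ 2)).
  by rewrite -exprMn ler_sqr ?nnegrE ?norm_ge0// mulr_ge0// ltW.
have -> : D ^+ 2 * (k ^+ 2 / 2 * (u 0 0 ^+ 2 + u 0 1 ^+ 2)) =
    (K ^+ 2 + k ^+ 2 / 2) * (u 0 0 ^+ 2 + u 0 1 ^+ 2).
  by rewrite D2; field; rewrite gt_eqF.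
by apply: ler_pM => //; rewrite ?exprn_ge0 ?(ltW K0)// lerDl ltW.
Qed.

(* With [w = 1 / (4 D^2 - 1)] both the constraints and the value [4 a c w] are
   polynomial, and [w] ranges over a compact interval. *)
Lemma best_ellipsoid_exists : exists a c D, best_ellipsoid N a c D.
Proof.
(* The constraints at the basis vectors bound [a] and [c], and [1 <= D] bounds [w] by [3^-1]. *)
pose B := Num.max (N (row2 1 0) ^+ 2) (Num.max (N (row2 0 1) ^+ 2) (3^-1)).
pose box := [set x : 'rV[R]_3 | forall i, `[0, B]%classic (x ord0 i)].
pose E (x : 'rV[R]_3) u := ellipsoid_dot (x 0 0) (x 0 1) u u.
pose A := box `&` [set x : 'rV[R]_3 | x 0 2%:R <= 3^-1] `&`
  \bigcap_(u in [set: 'rV[R]_2]) [set x | E x u <= N u ^+ 2] `&`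
  (* As [1 + w = 4 * w * D ^+ 2], this is the upper constraint multiplied by [4 * w]. *)
  \bigcap_(u in [set: 'rV[R]_2])
     [set x : 'rV[R]_3 | 4 * x 0 2%:R * N u ^+ 2 <= (1 + x 0 2%:R) * E x u].
pose f (x : 'rV[R]_3) := 4 * x 0 0 * x 0 1 * x 0 2%:R.
have cc i : continuous (fun x : 'rV[R]_3 => x 0 i) by move=> x; exact: coord_continuous.
have cE u : continuous (fun x => E x u).
  by apply: continuous_add; apply: continuous_mul; (exact: cc || exact: cst_continuous).
have compA : compact A.
  apply: (subclosed_compact _ (rV_compact (fun i : 'I_3 => @segment_compact R 0 B))).
    apply: closedI; [apply: closedI; [apply: closedI|]|].
    - rewrite (_ : box = \bigcap_(i in [set: 'I_3])
          ([set x : 'rV[R]_3 | 0 <= x 0 i] `&` [set x : 'rV[R]_3 | x 0 i <= B])).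
        by apply: closed_bigI => i _; apply: closedI; apply: closed_le_continuous;
          (exact: cc || exact: cst_continuous).
      apply/seteqP; split => x /= h i; last by have [? ?] := h i I; exact/andP.
      by move=> _; have /andP := h i.
    - by apply: closed_le_continuous; [exact: cc|exact: cst_continuous].
    - by apply: closed_bigI => u _; apply: closed_le_continuous;
        [exact: cE|exact: cst_continuous].
    - apply: closed_bigI => u _; apply: closed_le_continuous.
        apply: continuous_mul; last exact: cst_continuous.
        by apply: continuous_mul; [exact: cst_continuous|exact: cc].
      apply: continuous_mul; last exact: cE.
      by apply: continuous_add; [exact: cst_continuous|exact: cc].
  by move=> x [[[]]].
have cf : continuous f.
  by rewrite /f; do 3?[apply: continuous_mul]; (exact: cc || exact: cst_continuous).
have params_in a c D : ellipsoid_params N a c D -> exists2 x, A x & f x = ellipsoid_ratio a c D.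
  move=> /ellipsoid_paramsP[a0 c0 D1 hu].
  have dn := ellipsoid_denom_gt0 D1.
  pose w := (4 * D ^+ 2 - 1)^-1; have w0 : 0 < w by rewrite invr_gt0.
  have w3 : w <= 3^-1 by rewrite lef_pV2 ?posrE//; have := exprn_ege1 2 D1; lra.
  have aB : a <= N (row2 1 0) ^+ 2.
    by have /andP[+ _] := hu (row2 1 0); rewrite /ellipsoid_dot row20 row21; lra.
  have cB : c <= N (row2 0 1) ^+ 2.
    by have /andP[+ _] := hu (row2 0 1); rewrite /ellipsoid_dot row20 row21; lra.
  pose x : 'rV[R]_3 := \row_i nth 0 [:: a; c; w] i.
  have [x0 x1 x2] : [/\ x 0 0 = a, x 0 1 = c & x 0 2%:R = w] by split; rewrite mxE.
  exists x; last by rewrite /f x0 x1 x2.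
  split; [split; [split|]|].
  - move=> i; rewrite /= mxE; case: i => [[|[|[|//]]] ?] /=; rewrite in_itv/=.
    + by rewrite (ltW a0) /B le_max aB.
    + by rewrite (ltW c0) /B !le_max cB orbT.
    + by rewrite (ltW w0) /B !le_max w3 !orbT.
  - by rewrite /= x2.
  - by move=> u _ /=; rewrite /E x0 x1; case/andP: (hu u).
  - move=> u _ /=; rewrite /E x0 x1 x2; have /andP[_ h] := hu u.
    have -> : 1 + w = 4 * w * D ^+ 2 by rewrite /w; field; rewrite gt_eqF.
    by rewrite -[leRHS]mulrA ler_pM2l ?mulr_gt0.
have [a1 [c1 [D1 h1]]] := ellipsoid_params_exist.
have [x1 Ax1 fx1] := params_in _ _ _ h1.
have [|x] := compact_EVT_max (f := f) (ex_intro _ x1 Ax1) compA.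
  exact: continuous_subspaceT.
(* [A] contains degenerate points with a zero coordinate. The maximum is positive because admissible
   parameters exist, so no coordinate vanishes at the maximiser. *)
rewrite inE => Ax fmax; have fx : 0 < f x.
  apply: lt_le_trans (ellipsoid_ratio_gt0 h1) _; rewrite -fx1; apply: fmax.
  by rewrite inE.
case: Ax => [[[xbox x3] xE1] xE2].
set a := x 0 0; set c := x 0 1; set w := x 0 2%:R.
have ge0 i : 0 <= x 0 i by have := xbox i; rewrite /= in_itv/= => /andP[].
have a0 : 0 < a by rewrite lt_def ge0 andbT; apply: contra_ltN fx => /eqP a0;
  rewrite /f -/a a0 mulr0 !mul0r.
have c0 : 0 < c by rewrite lt_def ge0 andbT; apply: contra_ltN fx => /eqP c0;
  rewrite /f -/c c0 mulr0 mul0r.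
have w0 : 0 < w by rewrite lt_def ge0 andbT; apply: contra_ltN fx => /eqP w0;
  rewrite /f -/w w0 mulr0.
have w3 : 3 <= w^-1 by rewrite -[3]invrK lef_pV2 ?posrE.
have D2ge1 : 1 <= (w^-1 + 1) / 4 by lra.
pose D := Num.sqrt ((w^-1 + 1) / 4).
have D2 : D ^+ 2 = (w^-1 + 1) / 4 by rewrite sqr_sqrtr//; lra.
have hp : ellipsoid_params N a c D.
  apply/ellipsoid_paramsP; split=> // [|u].
    by rewrite -[1]sqrtr1 ler_wsqrtr.
  apply/andP; split; first exact: (xE1 u).
  have := xE2 u I; rewrite /= -/w -/a -/c => h.
  have w40 : 0 < 4 * w by rewrite mulr_gt0.
  rewrite -(ler_pM2l w40); apply: (le_trans h); rewrite D2 /E -/a -/c.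
  by rewrite le_eqVlt; apply/orP; left; apply/eqP; field; rewrite gt_eqF.
have fE : f x = ellipsoid_ratio a c D.
  rewrite /ellipsoid_ratio D2 (_ : 4 * _ - 1 = w^-1) ?invrK//.
  by field; rewrite gt_eqF.
exists a, c, D; split=> // a' c' D' h'.
apply: ellipsoid_value_le => //; rewrite -fE.
by have [x' Ax' <-] := params_in _ _ _ h'; apply: fmax; rewrite inE.
Qed.

End BestEllipsoid.

(** * Power inequalities and bounds for the ellipsoid ratio *)

Section PowerMeans.
Context {R : realType}.
Implicit Types (x y s t a c D A B : R).

(** Each term is its base times a power of exponent [s - 1], which is at most the same power of
    [x + y]. *)
Lemma powR_superadditive x y s : 0 <= x -> 0 <= y -> 1 <= s ->
  x `^ s + y `^ s <= (x + y) `^ s.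
Proof.
move=> x0 y0 s1; have s0 : 0 < s by exact: lt_le_trans s1.
have s10 : 0 <= s - 1 by rewrite subr_ge0.
rewrite -!(mulr_powRB1 _ s0) ?addr_ge0// mulrDl.
by rewrite lerD// ler_wpM2l// ge0_ler_powR// ?nnegrE ?addr_ge0// ?lerDl ?lerDr.
Qed.

(** Hoelder's inequality against the vector [(1, 1)], with conjugate exponents [s] and
    [(1 - s^-1)^-1]. *)
Lemma powR_sum_le x y s : 0 <= x -> 0 <= y -> 1 < s ->
  x + y <= (x `^ s + y `^ s) `^ s^-1 * 2 `^ (1 - s^-1).
Proof.
move=> x0 y0 s1; have s0 : 0 < s by exact: lt_trans s1.
have q0 : 0 < 1 - s^-1 by rewrite subr_gt0 invf_lt1.
have := @hoelder2 R x y 1 1 s (1 - s^-1)^-1 x0 y0 ler01 ler01 s0.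
rewrite invr_gt0 invrK !mulr1 !powR1 => /(_ q0); apply.
by rewrite addrC subrK.
Qed.

Lemma powR2D s t : 2 `^ (s + t) = 2 `^ s * 2 `^ t :> R.
Proof. by rewrite powRD// pnatr_eq0 implybT. Qed.

Lemma powR_quarter y : 0 <= y -> (y ^+ 4) `^ 4^-1 = y.
Proof. by move=> y0; rewrite -powR_mulrn// -powRrM divff// powRr1. Qed.

Lemma powRN4 y : 0 <= y -> (y `^ (- 4^-1)) ^+ 4 = y^-1.
Proof.
move=> y0; rewrite -powR_mulrn ?powR_ge0// -powRrM mulNr mulVf// powR_inv1//.
Qed.

Lemma ellipsoid_value_eq a c D M : 0 <= M -> M ^+ 4 = ellipsoid_ratio a c D ->
  M = ellipsoid_value a c D.
Proof. by move=> M0 ME; rewrite /ellipsoid_value -/(ellipsoid_ratio a c D) -ME powR_quarter. Qed.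

(* The bound is attained at [a = c = A] and [D^2 = 1/A]. *)
Lemma ellipsoid_ratio_corner a c D A : 0 < a -> 0 < c -> 1 <= D -> A <= 1 ->
  a + c <= 2 * A -> 1 <= D ^+ 2 * a -> 1 <= D ^+ 2 * c ->
  ellipsoid_ratio a c D <= 4 * A ^+ 3 / (4 - A).
Proof.
wlog ac : a c / a <= c => [H|].
  move=> a0 c0 D1 A1 acA Da Dc; have [|/ltW] := leP a c; first by move=> ?; exact: H.
  rewrite (_ : ellipsoid_ratio a c D = ellipsoid_ratio c a D).
    by move=> ?; apply: H => //; rewrite addrC.
  by rewrite /ellipsoid_ratio [4 * a * c]mulrAC.
move=> a0 c0 D1 A1 acA Da Dc.
have aA : a <= A by lra.
have A0 : 0 < A by exact: lt_le_trans aA.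
have dn := ellipsoid_denom_gt0 D1.
have A4 : 0 < 4 - A by lra.
rewrite /ellipsoid_ratio ler_pdivlMr// mulrAC ler_pdivrMr//.
have Da' : 4 / a - 1 <= 4 * D ^+ 2 - 1.
  by rewrite lerD2r ler_pdivrMr// -mulrA ler_peMr.
have h1 : 4 * a * c * (4 - A) <= 4 * a * (2 * A - a) * (4 - A).
  by rewrite ler_pM2r// ler_pM2l ?mulr_gt0// lerBrDl.
have h2 : 4 * A ^+ 3 * (4 / a - 1) <= 4 * A ^+ 3 * (4 * D ^+ 2 - 1).
  by rewrite ler_pM2l// mulr_gt0// exprn_gt0.
apply: (le_trans h1); apply: le_trans h2.
rewrite -(ler_pM2l a0).
have -> : a * (4 * A ^+ 3 * (4 / a - 1)) = 4 * A ^+ 3 * (4 - a) by field; rewrite gt_eqF.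
(* With [c] replaced by [2 * A - a] and [D ^+ 2] by [a^-1], equality holds at [a = A], so [A - a] is
   a factor of the difference. *)
rewrite -subr_ge0.
have -> : 4 * A ^+ 3 * (4 - a) - a * (4 * a * (2 * A - a) * (4 - A)) =
  4 * ((A - a) * (A ^+ 3 + (4 - A) * (A ^+ 2 + a * (A - a)))) by ring.
rewrite mulr_ge0// mulr_ge0 ?subr_ge0// addr_ge0 ?exprn_ge0 ?ltW//.
by rewrite mulr_gt0// ltr_wpDr ?exprn_gt0// mulr_ge0 ?subr_ge0// ltW.
Qed.

Lemma ellipsoid_ratio_unit a c D E : 0 < a -> 0 < c -> 1 <= D -> 1 <= E ->
  a <= 1 -> c <= 1 -> E ^+ 2 <= D ^+ 2 ->
  ellipsoid_ratio a c D <= ellipsoid_ratio 1 1 E.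
Proof.
move=> a0 c0 D1 E1 a1 c1 ED.
have dn := ellipsoid_denom_gt0 D1; have en := ellipsoid_denom_gt0 E1.
have ac1 : a * c <= 1 by rewrite mulr_ile1// ltW.
rewrite /ellipsoid_ratio; apply: ler_pM.
- by rewrite !mulr_ge0// ltW.
- by rewrite invr_ge0 ltW.
- by move: ac1; clear; lra.
- by rewrite lef_pV2 ?posrE//; move: ED; clear; lra.
Qed.

End PowerMeans.

(** * Best ellipsoids of the Euclidean, maximum and p-norms *)

Section SpecialNorms.
Context {R : realType}.
Implicit Types (a c D p : R) (u : 'rV[R]_2).

Lemma best_ellipsoidP (N : 'rV[R]_2 -> R) (hN : is_norm N) a c D :
  0 < a -> 0 < c -> 1 <= D ->
  (forall u, ellipsoid_dot a c u u <= N u ^+ 2 <= D ^+ 2 * ellipsoid_dot a c u u) ->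
  (forall a' c' D', 0 < a' -> 0 < c' -> 1 <= D' ->
    (forall u, ellipsoid_dot a' c' u u <= N u ^+ 2 <= D' ^+ 2 * ellipsoid_dot a' c' u u) ->
    ellipsoid_ratio a' c' D' <= ellipsoid_ratio a c D) ->
  best_ellipsoid N a c D.
Proof.
move=> a0 c0 D1 hu hbest.
have h : ellipsoid_params N a c D by apply/(ellipsoid_paramsP hN).
split=> // a' c' D' h'; apply: (ellipsoid_value_le h' h).
by have [? ? ? ?] := (ellipsoid_paramsP hN _ _ _).1 h'; exact: hbest.
Qed.

Lemma ellipsoid_dot_row2 a c (x y : R) :
  ellipsoid_dot a c (row2 x y) (row2 x y) = a * x ^+ 2 + c * y ^+ 2.
Proof. by rewrite /ellipsoid_dot row20 row21 !expr2. Qed.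

(** In each special case optimality already follows from the constraints at these three vectors. *)
Lemma ellipsoid_corners (N : 'rV[R]_2 -> R) a c D (x y z : R) :
  (forall u, ellipsoid_dot a c u u <= N u ^+ 2 <= D ^+ 2 * ellipsoid_dot a c u u) ->
  N (row2 1 0) ^+ 2 = x -> N (row2 0 1) ^+ 2 = y -> N (row2 1 1) ^+ 2 = z ->
  [/\ a <= x <= D ^+ 2 * a, c <= y <= D ^+ 2 * c & a + c <= z <= D ^+ 2 * (a + c)].
Proof.
move=> hu <- <- <-; have := hu (row2 1 0); have := hu (row2 0 1).
have := hu (row2 1 1); rewrite !ellipsoid_dot_row2 !expr1n !expr0n/=.
by rewrite !mulr1 !mulr0 !addr0 !add0r.
Qed.

Lemma best_ellipsoid_euclidean : is_norm (@euclidean_norm R) ->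
  best_ellipsoid (@euclidean_norm R) 1 1 1.
Proof.
move=> hN.
have NE u : euclidean_norm u ^+ 2 = u 0 0 ^+ 2 + u 0 1 ^+ 2.
  by rewrite sqr_sqrtr// addr_ge0 ?sqr_ge0.
apply: best_ellipsoidP => // [u|a c D a0 c0 D1 hu].
  by rewrite NE /ellipsoid_dot -!expr2 expr1n !mul1r lexx.
have [/andP[a1 _] /andP[c1 _] _] := ellipsoid_corners hu (NE _) (NE _) (NE _).
rewrite !row20 !row21 !expr1n !expr0n/= ?addr0 ?add0r in a1 c1.
by apply: ellipsoid_ratio_unit => //; rewrite expr1n exprn_ege1.
Qed.

(** The test vectors give [1 <= D ^+ 2 * a], [1 <= D ^+ 2 * c] and [a + c <= 1]: the corner bound
    applies with [A = 2^-1]. *)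
Lemma best_ellipsoid_maximum : is_norm (@maximum_norm R) ->
  best_ellipsoid (@maximum_norm R) 2^-1 2^-1 (Num.sqrt 2).
Proof.
move=> hN.
have s2 : Num.sqrt 2 ^+ 2 = 2 :> R by rewrite sqr_sqrtr.
have sq (x : R) : x ^+ 2 = `|x| ^+ 2 by rewrite real_normK ?num_real.
apply: best_ellipsoidP => // [|u|a c D a0 c0 D1 hu].
- by rewrite -[leLHS]sqrtr1 ler_wsqrtr// ler1n.
- rewrite s2 /ellipsoid_dot -!expr2 !(sq (u _ _)) /maximum_norm.
  move: (normr_ge0 (u 0 0)) (normr_ge0 (u 0 1)).
  move: `|u 0 0| `|u 0 1| => x y x0 y0.
  by case: (leP x y) => xy; apply/andP; split; nra.
have M10 : maximum_norm (row2 1 0) ^+ 2 = 1 :> R.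
  by rewrite /maximum_norm row20 row21 normr1 normr0 max_l// expr1n.
have M01 : maximum_norm (row2 0 1) ^+ 2 = 1 :> R.
  by rewrite /maximum_norm row20 row21 normr1 normr0 max_r// expr1n.
have M11 : maximum_norm (row2 1 1) ^+ 2 = 1 :> R.
  by rewrite /maximum_norm row20 row21 normr1 max_l// expr1n.
have [/andP[_ h10] /andP[_ h01] /andP[h11 _]] := ellipsoid_corners hu M10 M01 M11.
have -> : ellipsoid_ratio 2^-1 2^-1 (Num.sqrt 2) = 4 * 2^-1 ^+ 3 / (4 - 2^-1) :> R.
  by rewrite /ellipsoid_ratio s2; field.
by apply: ellipsoid_ratio_corner => //; lra.
Qed.

(** In the squared coordinates, comparison with a multiple of the Euclidean form becomes comparison
    of the exponents [p / 2] and [1]. *)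
Lemma p_norm_sqr p u : 0 < p ->
  p_norm p u ^+ 2 = ((u 0 0 ^+ 2) `^ (p / 2) + (u 0 1 ^+ 2) `^ (p / 2)) `^ (p / 2)^-1.
Proof.
move=> p0; rewrite /p_norm -powR_mulrn ?powR_ge0// -powRrM invf_div mulrC.
have sqp (x : R) : `|x| `^ p = (x ^+ 2) `^ (p / 2).
  by rewrite -(real_normK (num_real x)) -powR_mulrn// -powRrM mulrC divfK.
by rewrite !sqp mulrC [_^-1 * _]mulrC.
Qed.

Lemma p_norm_sqr_row2 p : 0 < p ->
  [/\ p_norm p (row2 1 0) ^+ 2 = 1, p_norm p (row2 0 1) ^+ 2 = 1 &
      p_norm p (row2 1 1) ^+ 2 = 2 `^ (2 / p) :> R].
Proof.
move=> p0; have p20 : p / 2 != 0 by rewrite gt_eqF// divr_gt0.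
have one (x : R) : 1 `^ x = 1 by rewrite powR1.
have zero : 0 `^ (p / 2) = 0 :> R by exact: powR0.
by split; rewrite (p_norm_sqr _ p0) row20 row21 ?expr1n ?expr0n/= ?zero ?one ?addr0 ?add0r
  ?one ?invf_div.
Qed.

(** Here [p / 2 > 1]: Hoelder gives the lower bound, superadditivity the upper one. Since
    [D ^+ 2 * A = 1] and the squared norm of [(1, 1)] is [2 * A], optimality is the corner bound. *)
Lemma best_ellipsoid_p_gt2 p : 2 < p -> is_norm (@p_norm R p) ->
  best_ellipsoid (p_norm p) (2 `^ (2 / p - 1)) (2 `^ (2 / p - 1))
                 (2 `^ (2^-1 - p^-1)).
Proof.
move=> p2 hN; have p0 : 0 < p by exact: lt_trans p2.
set A := 2 `^ (2 / p - 1); set D := 2 `^ _.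
have A0 : 0 < A by rewrite powR_gt0.
have pinv : p^-1 < 2^-1 by rewrite ltf_pV2 ?posrE.
have A1 : A <= 1.
  by rewrite -(powRr0 2) ler_powR ?ler1n// subr_le0 ler_pdivrMr// mul1r ltW.
have D1 : 1 <= D by rewrite -(powRr0 2) ler_powR ?ler1n// subr_ge0 ltW.
have DA : D ^+ 2 * A = 1.
  rewrite -powR_mulrn ?powR_ge0// -powRrM -powR2D -[RHS](powRr0 2); congr (_ `^ _).
  by field; rewrite gt_eqF.
have A2 : 2 `^ (2 / p) = 2 * A.
  by rewrite /A powR2D powR_inv1// mulrCA divff// mulr1.
have r1 : 1 < p / 2 by rewrite ltr_pdivlMr// mul1r.
have r0 : 0 < p / 2 by exact: lt_trans r1.
have [N10 N01 N11] := p_norm_sqr_row2 p0.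
apply: best_ellipsoidP => // [u|a c D' a0 c0 D'1 hu].
  rewrite p_norm_sqr// /ellipsoid_dot -!expr2 -mulrDr mulrA DA mul1r.
  have x0 := sqr_ge0 (u 0 0); have y0 := sqr_ge0 (u 0 1).
  move: (_ ^+ 2) (_ ^+ 2) x0 y0 => y x x0 y0; apply/andP; split.
    have E : A * 2 `^ (1 - (p / 2)^-1) = 1.
      rewrite -powR2D -[RHS](powRr0 2); congr (_ `^ _).
      by rewrite invf_div addrC addrA subrK subrr.
    have h := powR_sum_le x0 y0 r1; apply: le_trans (ler_wpM2l (ltW A0) h) _.
    by rewrite mulrCA E mulr1.
  have h := powR_superadditive x0 y0 (ltW r1).
  have E : x + y = ((x + y) `^ (p / 2)) `^ (p / 2)^-1.
    by rewrite -powRrM divff ?gt_eqF// powRr1// addr_ge0.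
  rewrite [leRHS]E.
  by rewrite ge0_ler_powR ?nnegrE ?addr_ge0 ?powR_ge0 ?invr_ge0// ltW.
have [/andP[_ h10] /andP[_ h01] /andP[h11 _]] := ellipsoid_corners hu N10 N01 N11.
rewrite A2 in h11; clearbody A D.
have -> : ellipsoid_ratio A A D = 4 * A ^+ 3 / (4 - A).
  have D2 : D ^+ 2 = A^-1 by rewrite -[RHS]mul1r -DA mulfK// gt_eqF.
  have A4 : 0 < 4 - A by move: A1; clear; lra.
  by rewrite /ellipsoid_ratio D2; field; rewrite !gt_eqF.
exact: ellipsoid_ratio_corner.
Qed.

(** Here the two power inequalities are applied with exponent [2 / p > 1] and exchange their roles.
    For optimality the basis vectors give [a <= 1] and [c <= 1], and [(1, 1)] then gives
    [D ^+ 2 <= D' ^+ 2]. *)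
Lemma best_ellipsoid_p_lt2 p : 1 <= p < 2 -> is_norm (@p_norm R p) ->
  best_ellipsoid (p_norm p) 1 1 (2 `^ (p^-1 - 2^-1)).
Proof.
move=> /andP[p1 p2] hN; have p0 : 0 < p by exact: lt_le_trans p1.
set D := 2 `^ _.
have pinv : 2^-1 < p^-1 by rewrite ltf_pV2 ?posrE.
have D1 : 1 <= D by rewrite -(powRr0 2) ler_powR ?ler1n// subr_ge0 ltW.
have D2 : D ^+ 2 = 2 `^ (2 / p - 1).
  rewrite -powR_mulrn ?powR_ge0// -powRrM; congr (_ `^ _).
  by field; rewrite gt_eqF.
have D2' : 2 `^ (2 / p) = 2 * D ^+ 2.
  by rewrite D2 powR2D powR_inv1// mulrCA divff// mulr1.
have s1 : 1 < 2 / p by rewrite ltr_pdivlMr// mul1r.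
have s0 : 0 < 2 / p by exact: lt_trans s1.
have [N10 N01 N11] := p_norm_sqr_row2 p0.
apply: best_ellipsoidP => // [u|a c D' a0 c0 D'1 hu].
  rewrite p_norm_sqr// /ellipsoid_dot -!expr2 !mul1r invf_div.
  have powK (x : R) : 0 <= x -> (x `^ (p / 2)) `^ (2 / p) = x.
    move=> x0; rewrite -powRrM (_ : _ * _ = 1) ?powRr1//.
    by field; rewrite gt_eqF.
  have x0 := sqr_ge0 (u 0 0); have y0 := sqr_ge0 (u 0 1).
  have xE := powK _ x0; have yE := powK _ y0.
  have := powR_ge0 (u 0 0 ^+ 2) (p / 2); have := powR_ge0 (u 0 1 ^+ 2) (p / 2).
  move: {x0 y0} (u 0 0 ^+ 2) (u 0 1 ^+ 2) xE yE => X Y.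
  move: (X `^ (p / 2)) (Y `^ (p / 2)) => x y <- <- y0 x0.
  rewrite powR_superadditive// ?(ltW s1)//=.
  have h := powR_sum_le x0 y0 s1.
  have h' : (x + y) `^ (2 / p) <=
      ((x `^ (2 / p) + y `^ (2 / p)) `^ (2 / p)^-1 * 2 `^ (1 - (2 / p)^-1)) `^ (2 / p).
    apply: ge0_ler_powR => //; rewrite ?nnegrE; first exact: ltW.
      exact: addr_ge0.
    by rewrite mulr_ge0 ?powR_ge0.
  apply: (le_trans h'); rewrite powRM ?powR_ge0// -!powRrM mulVf ?gt_eqF//.
  rewrite powRr1 ?addr_ge0 ?powR_ge0// mulrC D2 ler_wpM2r ?addr_ge0 ?powR_ge0//.
  by rewrite mulrBl mul1r mulVf// gt_eqF.
have [/andP[a1 _] /andP[c1 _] /andP[_ h11]] := ellipsoid_corners hu N10 N01 N11.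
rewrite D2' in h11; clear D2 D2' hu N11; clearbody D.
have D'2 : D ^+ 2 <= D' ^+ 2.
  have : D' ^+ 2 * (a + c) <= D' ^+ 2 * 2.
    by rewrite ler_wpM2l ?sqr_ge0//; move: a1 c1; clear; lra.
  by move: h11; clear; lra.
exact: ellipsoid_ratio_unit.
Qed.

End SpecialNorms.

(** * Closed forms of the constant for the p-norms *)

Section SpecialValues.
Context {R : realType}.
Implicit Types p : R.

(** In terms of [B], [a = c = B / 2] and [D ^+ 2 = 2 / B], so both sides have fourth power
    [B ^+ 3 / (8 - B)]. *)
Lemma ellipsoid_value_eq_p_gt2 p : 2 < p ->
  8 `^ (2 * p)^-1 * (8 - 4 `^ p^-1) `^ (- 4^-1) =
  ellipsoid_value (2 `^ (2 / p - 1)) (2 `^ (2 / p - 1)) (2 `^ (2^-1 - p^-1)).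
Proof.
move=> p2; have p0 : 0 < p by exact: lt_trans p2.
set B : R := 4 `^ p^-1; have B0 : 0 < B by rewrite powR_gt0.
have B8 : 0 < 8 - B.
  have h : B <= 4 `^ 1 by rewrite ler_powR ?ler1n// invf_le1// ltW// (lt_trans _ p2)// ltr1n.
  by move: h; rewrite powRr1//; clear; lra.
have BE : B = 2 `^ (2 / p).
  by rewrite powRrM powR_mulrn// (_ : 2 ^+ 2 = 4)//; ring.
have AE : 2 `^ (2 / p - 1) = B / 2 by rewrite powR2D powR_inv1// BE.
have D2 : (2 `^ (2^-1 - p^-1)) ^+ 2 = 2 / B.
  rewrite -powR_mulrn ?powR_ge0// -powRrM BE -powRN.
  have -> : (2^-1 - p^-1) * 2 = 1 - 2 / p by field; rewrite gt_eqF.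
  by rewrite powR2D powRr1.
have E8 : (8 `^ (2 * p)^-1) ^+ 4 = B ^+ 3.
  have e8 : 8 = 2 `^ 3%:R :> R by rewrite powR_mulrn//; ring.
  have -> : B ^+ 3 = 2 `^ (2 / p * 3%:R) by rewrite BE [RHS]powRrM powR_mulrn// powR_ge0.
  rewrite -(powR_mulrn 4) ?powR_ge0// e8 -!powRrM; congr (_ `^ _).
  by field; rewrite gt_eqF.
apply: ellipsoid_value_eq; first by rewrite mulr_ge0// powR_ge0.
rewrite exprMn E8 powRN4 ?(ltW B8)// /ellipsoid_ratio AE D2.
have -> : 4 * (2 / B) - 1 = (8 - B) / B by field; rewrite gt_eqF.
by field; rewrite (gt_eqF B0) (gt_eqF B8).
Qed.

Lemma ellipsoid_value_eq_p_lt2 p : 1 <= p < 2 ->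
  Num.sqrt 2 * (2 `^ (1 + 2 / p) - 1) `^ (- 4^-1) =
  ellipsoid_value 1 1 (2 `^ (p^-1 - 2^-1)).
Proof.
move=> /andP[p1 _]; have p0 : 0 < p by exact: lt_le_trans p1.
have D2 : 4 * (2 `^ (p^-1 - 2^-1)) ^+ 2 = 2 `^ (1 + 2 / p).
  rewrite -powR_mulrn ?powR_ge0// -powRrM (_ : 4 = 2 `^ 2%:R); last first.
    by rewrite powR_mulrn//; ring.
  rewrite -powR2D; congr (_ `^ _).
  by field; rewrite gt_eqF.
have h : 0 < 2 `^ (1 + 2 / p) - 1 :> R.
  rewrite subr_gt0 powR2D powRr1// (lt_le_trans (ltr1n _ 2))//.
  rewrite ler_peMr// -[leLHS](powRr0 2) ler_powR ?ler1n//.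
  by rewrite divr_ge0// ltW.
apply: ellipsoid_value_eq; first by rewrite mulr_ge0 ?sqrtr_ge0 ?powR_ge0.
rewrite exprMn (exprM _ 2 2) sqr_sqrtr// powRN4 ?(ltW h)// /ellipsoid_ratio D2.
by rewrite !mulr1; congr (_ / _); ring.
Qed.

End SpecialValues.

(** * Bases of the integer lattice and the initial triple *)

Section Basis.
Context {R : realType}.
Implicit Types x y z w : int * 'rV[int]_2.

Definition vec3 x : 'rV[int]_3 := row_mx (x.1)%:M x.2.

Lemma vec3_lincomb i j k x y z :
  vec3 (lincomb i j k x y z) = i *: vec3 x + j *: vec3 y + k *: vec3 z.
Proof.
apply/rowP => r; rewrite !mxE; case: (fintype.split (r : 'I_(1 + 2))) => s /=; rewrite !mxE// ord1.
by rewrite !mulr1n.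
Qed.

Lemma vec3_inj : injective vec3.
Proof.
move=> [x1 x2] [y1 y2] /(@eq_row_mx _ 1 1 2)[/matrixP/(_ 0 0) + /= E2]; rewrite E2 /=.
by rewrite !mxE !mulr1n => ->.
Qed.

Lemma vec3_surj (t : 'rV[int]_3) : exists x, t = vec3 x.
Proof.
exists ((lsubmx (t : 'rV_(1 + 2))) 0 0, rsubmx (t : 'rV_(1 + 2))).
by rewrite /vec3/= -mx11_scalar hsubmxK.
Qed.

(** Projection along [z] removes [k], determinants with the two other displacements isolate [i] and
    [j], and the first coordinate then gives [k]. *)
Lemma lincomb_eq0 (v : 'rV[R]_2) i j k x y z : disp v z = 0 ->
  det2 (disp v y) (disp v x) != 0 -> z.1 != 0 ->
  lincomb i j k x y z = (0, 0) -> [/\ i = 0, j = 0 & k = 0].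
Proof.
move=> vz dxy z0 E.
have : i%:~R *: disp v x + j%:~R *: disp v y = 0.
  have := disp_lincomb v i j k x y z; rewrite E vz scaler0 addr0 => <-.
  by apply: row2P; rewrite !mxE/= mul0r subr0.
set X := disp v x in dxy *; set Y := disp v y in dxy * => XY.
have i0 : i = 0.
  have : det2 Y (i%:~R *: X + j%:~R *: Y) = i%:~R * det2 Y X by rewrite /det2 !mxE; ring.
  rewrite XY [LHS](_ : _ = 0); last by rewrite /det2 !mxE; ring.
  by move=> /esym/eqP; rewrite mulf_eq0 (negbTE dxy) orbF intr_eq0 => /eqP.
have j0 : j = 0.
  have : det2 (i%:~R *: X + j%:~R *: Y) X = j%:~R * det2 Y X by rewrite /det2 !mxE; ring.
  rewrite XY [LHS](_ : _ = 0); last by rewrite /det2 !mxE; ring.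
  by move=> /esym/eqP; rewrite mulf_eq0 (negbTE dxy) orbF intr_eq0 => /eqP.
split=> //; move: E => [+ _]; rewrite i0 j0 !mul0r !add0r => /eqP.
by rewrite mulf_eq0 (negbTE z0) orbF => /eqP.
Qed.

Lemma frame_lattice_basis (e1 e2 : 'rV[R]_2) kap x y z :
  frame e1 e2 kap x y z -> lattice_basis (vec3 x) (vec3 y) (vec3 z).
Proof.
move=> [/andP[y0 yz] det1 _ sp] t.
have z0 : z.1 != 0 by rewrite gt_eqF// (le_lt_trans y0 yz).
have [w ->] := vec3_surj t; have [i [j [k wE]]] := sp w.
exists (i, j, k); split=> [|[[i' j'] k'] /= E]; first by rewrite /= wE vec3_lincomb.
have {}E : lincomb i j k x y z = lincomb i' j' k' x y z.
  by apply: vec3_inj; rewrite -wE E vec3_lincomb.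
have d0 : det2 (disp (center z : 'rV[R]_2) y) (disp (center z) x) != 0.
  apply/eqP => d0; move: det1; rewrite d0 mulr0 expr0n => /eqP.
  by rewrite eq_sym oner_eq0.
have sub0 : lincomb (i - i') (j - j') (k - k') x y z = (0, 0).
  move: E => [E1 E2]; congr pair => /=.
    have -> : (i - i') * x.1 + (j - j') * y.1 + (k - k') * z.1 =
      i * x.1 + j * y.1 + k * z.1 - (i' * x.1 + j' * y.1 + k' * z.1) by ring.
    by rewrite E1 subrr.
  have -> : (i - i') *: x.2 + (j - j') *: y.2 + (k - k') *: z.2 =
      i *: x.2 + j *: y.2 + k *: z.2 - (i' *: x.2 + j' *: y.2 + k' *: z.2).
    by apply/rowP => r; rewrite !mxE; ring.
  by rewrite E2 subrr.
have [/eqP + /eqP + /eqP] := lincomb_eq0 (disp_center z0) d0 z0 sub0.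
by rewrite !subr_eq0 => /eqP -> /eqP -> /eqP ->.
Qed.

(** Cramer's rule for the unimodular pair [e], [f]. *)
Lemma spans_initial (e f : 'rV[int]_2) : e 0 0 * f 0 1 - e 0 1 * f 0 0 = 1 ->
  spans (0, f) (0, - e) (1, 0).
Proof.
move=> ef [w p]; pose i := e 0 0 * p 0 1 - e 0 1 * p 0 0.
pose j := f 0 0 * p 0 1 - f 0 1 * p 0 0.
exists i, j, w; congr pair; first by rewrite /= !mulr0 !add0r mulr1.
apply/rowP => r; rewrite !mxE mulr0 addr0 mulrN.
have [->|->] := ord2_eq r.
  rewrite -[LHS]mul1r -ef /i /j; ring.
rewrite -[LHS]mul1r -ef /i /j; ring.
Qed.

(** [center (1, 0)] is the origin, where [(0, p)] has displacement [- p]; the sign in [(0, - e)]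
    thus puts its displacement [e] in the cone. *)
Lemma frame_initial (e1 e2 : 'rV[R]_2) (e f : 'rV[int]_2) :
  in_cone e1 e2 (int_vec e) -> e 0 0 * f 0 1 - e 0 1 * f 0 0 = 1 ->
  frame e1 e2 1 (0, f) (0, - e) (1, 0).
Proof.
move=> cone ef; have dE p : disp (center (1, 0)) (0, p) = - int_vec p :> 'rV[R]_2.
  by rewrite /disp/= scale0r sub0r.
have NE : int_vec (- e) = - int_vec e :> 'rV[R]_2.
  by apply: row2P; rewrite !mxE rmorphN.
split=> //; rewrite ?dE ?NE ?opprK ?scale1r//; last exact: spans_initial.
have -> : det2 (int_vec e) (- int_vec f) =
    - (e 0 0 * f 0 1 - e 0 1 * f 0 0)%:~R :> R.
  by rewrite /det2 !mxE rmorphB !rmorphM/=; ring.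
by rewrite ef mul1r sqrrN expr1n.
Qed.

End Basis.

(** * Properties of the point attached to one branch *)

Section Branch.
Context {R : realType}.
Variables (N : 'rV[R]_2 -> R) (hN : is_norm N).

(** Each [q n.+1] is least in a set determined by [v] and [q n]; this makes different branches yield
    different points. *)
Lemma best_approximations_unique (v : 'rV[R]_2) q p q' p' :
  best_approximations N v q p -> best_approximations N v q' p' -> q =1 q'.
Proof.
move=> [q0 _ qmin _] [q'0 _ q'min _]; elim=> [|n IH]; first by rewrite q0 q'0.
have [h1 h2] := qmin n; have [h3 h4] := q'min n; rewrite IH in h1 h2.
by apply/eqP; rewrite eqn_leq h2// h4.
Qed.

Lemma quadrantZ (s t : bool) (k : R) u : 0 < k -> quadrant s t u -> quadrant s t (k *: u).
Proof.
by move=> k0 [h1 h2]; split; rewrite mxE mulrCA mulr_gt0.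
Qed.

Lemma quadrantN (s t : bool) (u : 'rV[R]_2) :
  quadrant s t (- u) -> quadrant (~~ s) (~~ t) u.
Proof.
by move=> [h1 h2]; split; [move: h1|move: h2]; rewrite mxE signrN mulNr mulrN.
Qed.

Variables (a c D : R) (hE : ellipsoid_params N a c D).
Variables (lo hi : nat -> R) (e1 e2 : 'rV[R]_2) (m : nat) (z : int -> int).
Variables (S : nat -> @state R).
Hypothesis inv0 : state_inv e1 e2 m z 0 (S 0).
Hypothesis S0 : (st_h (S 0)).1 = 1.
Hypothesis step : forall n, state_step N lo hi e1 e2 m z n (S n) (S n.+1).
Variable v : 'rV[R]_2.
Hypothesis hv : forall n, `|v - center (st_h (S n))| <= st_r (S n).

Let b n := st_h (S n).

Lemma branch_inv n : state_inv e1 e2 m z n (S n).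
Proof. by case: n => [//|n]; case: (step n). Qed.

Lemma branch_stg n : st_g (S n.+1) = b n. Proof. by case: (step n). Qed.

Lemma branch_stf n : st_f (S n.+2) = b n.
Proof. by rewrite -branch_stg; case: (step n.+1). Qed.

Lemma branch_admissible n :
  admissible N (lo n) (hi n) e1 e2 ((-1) ^+ n.+1) (st_g (S n)) (b n) (b n.+1) v.
Proof. by have [_ _ _ _ /(_ v (hv n.+1))[]] := step n. Qed.

Lemma branch_lt n : (b n).1 < (b n.+1).1.
Proof. by have [[/andP[_]]] := branch_inv n.+1; rewrite branch_stg. Qed.

Lemma branch_decr n : N (disp v (b n.+1)) < N (disp v (b n)).
Proof. by have [_ _] := branch_admissible n.+1; rewrite branch_stg. Qed.

Lemma branch_shortest n x : 0 < x.1 -> x.1 < (b n.+1).1 ->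
  N (disp v (b n)) <= N (disp v x).
Proof.
move=> x0 xb; have [_ _ _ _ H] := branch_admissible n.
(* The exceptional vector is controlled by the fourth admissibility condition of stage [n.+1]. *)
have [->|/eqP xE] := eqVneq x ((b n.+1).1 - (b n).1, (b n.+1).2 - (b n).2); last exact: H.
by have [_ _ _ + _] := branch_admissible n.+1; rewrite branch_stg disp_subr.
Qed.

Lemma branch_best_approximations :
  best_approximations N v (fun n => `|(b n).1|%N) (fun n => (b n).2).
Proof.
exact: (minimal_best_approximations hN S0 branch_lt branch_decr branch_shortest).
Qed.

Lemma branch_natE n : `|(b n).1|%N%:Z = (b n).1.
Proof. exact: (minimal_natE S0 branch_lt). Qed.

Lemma branch_irrational : ~ rational_point v.
Proof. exact: (minimal_irrational hN S0 branch_lt branch_decr branch_shortest). Qed.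

Lemma branch_long_displacement n :
  long_displacement v (fun n => `|(b n).1|%N) (fun n => (b n).2) n =
  Num.sqrt (b n.+1).1%:~R *: disp v (b n).
Proof.
rewrite /long_displacement pmulrn branch_natE; congr (_ *: _).
exact: (minimal_dispE v S0 branch_lt).
Qed.

Lemma branch_long_displacement_norm n :
  lo n <= N (long_displacement v (fun n => `|(b n).1|%N) (fun n => (b n).2) n) <= hi n.
Proof.
rewrite branch_long_displacement normZ// ger0_norm ?sqrtr_ge0//.
by case: (branch_admissible n).
Qed.

Lemma branch_Omega theta delta n :
  (forall u, in_cone e1 e2 u -> Omega theta delta u) ->
  Omega theta delta
    (long_displacement v (fun n => `|(b n).1|%N) (fun n => (b n).2) n).
Proof.
move=> hO; rewrite branch_long_displacement; apply: OmegaZ.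
have [_ /hO h _ _ _] := branch_admissible n.
(* [Omega] is a double cone, so the alternating sign can be multiplied away. *)
have := OmegaZ ((-1) ^+ n.+1) h.
by rewrite scalerA -exprMn mulrNN mulr1 expr1n scale1r.
Qed.

Lemma branch_opposite_quadrants (s t : bool) n :
  (forall u, in_cone e1 e2 u -> quadrant s t u) ->
  opposite_quadrants
    (long_displacement v (fun n => `|(b n).1|%N) (fun n => (b n).2) n)
    (long_displacement v (fun n => `|(b n).1|%N) (fun n => (b n).2) n.+1).
Proof.
move=> hQ; rewrite !branch_long_displacement.
have sq k : 0 < Num.sqrt (b k).1%:~R :> R.
  by rewrite sqrtr_gt0 ltr0z (minimal_gt0 S0 branch_lt).
have [_ /hQ h1 _ _ _] := branch_admissible n.
have [_ /hQ h2 _ _ _] := branch_admissible n.+1.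
rewrite exprS mulN1r scaleNr in h2.
(* Consecutive displacements enter the same quadrant after multiplication by opposite signs; [e]
   stands for [(-1) ^+ n.+1]. *)
have : forall e : R, e = 1 \/ e = -1 -> quadrant s t (e *: disp v (b n)) ->
    quadrant s t (- (e *: disp v (b n.+1))) ->
    exists s t, quadrant s t (disp v (b n)) /\ quadrant (~~ s) (~~ t) (disp v (b n.+1)).
  move=> _ [->|->]; rewrite ?scale1r ?scaleN1r ?opprK => q1 q2.
    by exists s, t; split => //; exact: quadrantN.
  by exists (~~ s), (~~ t); split; [exact: quadrantN|rewrite !negbK].
move=> /(_ ((-1) ^+ n.+1)) [||//|s' [t' [h3 h4]]] //.
  by rewrite -signr_odd; case: odd; [right|left].
by exists s', t'; split; exact: quadrantZ.
Qed.

Lemma branch_not_badly_approximable M : (forall n, hi n <= M) ->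
  ~ badly_approximable N v.
Proof.
move=> hM; apply: (minimal_not_badly_approximable hN S0 branch_lt branch_shortest (M := M)).
  by move=> n; case: (step n).
move=> n; apply: le_trans (hM n).
by have [/andP[]] := branch_admissible n.
Qed.

Lemma branch_lattice_basis n : (2 <= n)%N ->
  lattice_basis (approx_vec `|(b (n - 2)).1|%N (b (n - 2)).2)
    (approx_vec `|(b (n - 1)).1|%N (b (n - 1)).2) (approx_vec `|(b n).1|%N (b n).2).
Proof.
case: n => [//|[//|n]] _; rewrite /approx_vec !branch_natE subn2 subn1/=.
have [fr _ _ _ _] := branch_inv n.+2.
by have := frame_lattice_basis fr; rewrite branch_stg branch_stf.
Qed.

End Branch.

(** * The set of admissible vectors and the value of the constant *)

Section Main.
Context {R : realType}.
Variables (N : 'rV[R]_2 -> R) (hN : is_norm N).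
Variables (a c D : R) (hE : ellipsoid_params N a c D).

Lemma ellipsoid_value_gt0 : 0 < ellipsoid_value a c D.
Proof. by rewrite powR_gt0// (ellipsoid_ratio_gt0 hE). Qed.

(** The form in which the constant enters the step: a strict inequality between fourth powers. *)
Lemma ellipsoid_value_lt (x : R) : 0 <= x -> x < ellipsoid_value a c D ->
  (4 * D ^+ 2 - 1) * x ^+ 4 < 4 * a * c.
Proof.
move=> x0 xM; have [_ _ D1 _] := hE.
have r0 := ellipsoid_ratio_gt0 hE.
have M4 : ellipsoid_value a c D ^+ 4 = ellipsoid_ratio a c D.
  rewrite /ellipsoid_value -/(ellipsoid_ratio a c D) -powR_mulrn ?powR_ge0//.
  by rewrite -powRrM mulVf// powRr1// ltW.
have -> : 4 * a * c = (4 * D ^+ 2 - 1) * ellipsoid_value a c D ^+ 4.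
  by rewrite M4 /ellipsoid_ratio [RHS]mulrC divfK// gt_eqF// ellipsoid_denom_gt0.
by rewrite ltr_pM2l ?ellipsoid_denom_gt0// ltrXn2r.
Qed.

Lemma card_admissible_vectors (theta delta : R) (I : nat -> set R) (m : nat)
    (z : int -> int) (M := ellipsoid_value a c D) :
  0 < delta -> (forall n, exists lo hi : R, lo < hi /\ I n = `[lo, hi]%classic) ->
  (forall n, I n `<=` `[0, M]%classic) -> (0 < m)%N -> residue_sequence m z ->
  [set v : 'rV[R]_2 | ~ rational_point v /\
     exists (q : nat -> nat) (p : nat -> 'rV[int]_2),
       best_approximations N v q p /\
       (forall n, I n (N (long_displacement v q p n))) /\
       (forall n, Omega theta delta (long_displacement v q p n)) /\
       (forall n, opposite_quadrants (long_displacement v q p n)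
                                     (long_displacement v q p n.+1)) /\
       (forall n : nat, (1 <= n)%N ->
          ((q n)%:Z = z n%:Z %[mod m%:Z])%Z) /\
       ~ badly_approximable N v /\
       (forall n : nat, (2 <= n)%N ->
          lattice_basis (approx_vec (q (n - 2)%N) (p (n - 2)%N))
                        (approx_vec (q (n - 1)%N) (p (n - 1)%N))
                        (approx_vec (q n) (p n)))]
  #= [set: R].
Proof.
move=> delta0 hI hM m0 hz.
have /choice[lohi hlohi] n : exists p : R * R,
    [/\ 0 < p.1 < p.2, p.2 < M & `[p.1, p.2]%classic `<=` I n].
  have [lo [hi [lh E]]] := hI n; have := hM n; rewrite E => sub.
  have /andP[lo0 _] : 0 <= lo <= M.
    by have := sub lo; rewrite /= !in_itv/= lexx (ltW lh); apply.
  have /andP[_ hM'] : 0 <= hi <= M.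
    by have := sub hi; rewrite /= !in_itv/= lexx (ltW lh); apply.
  (* The middle third avoids [0] and [M] even when the interval touches them. *)
  exists ((2 * lo + hi) / 3, (lo + 2 * hi) / 3); split => /=; [lra|lra|].
  by move=> x /=; rewrite !in_itv/= => /andP[h1 h2]; apply/andP; split; lra.
pose lo n := (lohi n).1; pose hi n := (lohi n).2.
have lh n : 0 < lo n < hi n by case: (hlohi n).
have hi0 n : 0 < hi n by case/andP: (lh n) => h1 h2; exact: lt_trans h2.
have hiM n : (4 * D ^+ 2 - 1) * hi n ^+ 4 < 4 * a * c.
  by apply: ellipsoid_value_lt; [exact: ltW|case: (hlohi n)].
have [e1 [e2 [s [t [hO hQ [e [f [cone ef]]]]]]]] := ex_cone theta delta0.
pose st0 := State (0, f) (0, - e) (1, 0) (1 : R).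
have [z0 zm1 zm2 _] := hz.
have inv0 : state_inv e1 e2 m z 0 st0.
  split=> //=; rewrite ?expr0 ?z0 ?sub0r ?zm1 ?zm2//.
  exact: frame_initial.
have [F [F0 Fstep Finj]] := branching_exists hN hE lh hiM m0 hz inv0.
have Finv w : state_inv e1 e2 m z 0 (F w 0) by rewrite F0.
have F1 w : (st_h (F w 0)).1 = 1 by rewrite F0.
have Fr w n : 0 < st_r (F w n).
  by have [] := branch_inv (Finv w) (Fstep w) n.
have /choice[V hV] w : exists v, forall n, `|v - center (st_h (F w n))| <= st_r (F w n).
  apply: nested_boxes => // n v hv.
  by have [_ _ _ _ /(_ v hv)[]] := Fstep w n.
have best w := branch_best_approximations hN (Finv w) (F1 w) (Fstep w) (hV w).
(* Equal limit points have equal denominators, and these determine the binary sequence. *)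
apply: (card_eq_real (h := V)) => [w w' E|w].
  apply: Finj => n; have best' := best w'; rewrite -E in best'.
  have qE : `|(st_h (F w n)).1|%N = `|(st_h (F w' n)).1|%N.
    exact: best_approximations_unique (best w) best' n.
  rewrite -(branch_natE (Finv w) (F1 w) (Fstep w)) qE.
  exact: (branch_natE (Finv w') (F1 w') (Fstep w')).
split; first exact: (branch_irrational hN (Finv w) (F1 w) (Fstep w) (hV w)).
exists (fun n => `|(st_h (F w n)).1|%N), (fun n => (st_h (F w n)).2).
split; first exact: best.
split=> [n|].
  have [_ _] := hlohi n; apply; rewrite /= in_itv/=.
  exact: (branch_long_displacement_norm hN (Finv w) (F1 w) (Fstep w) (hV w)).
split=> [n|]; first exact: (branch_Omega (Finv w) (F1 w) (Fstep w) (hV w)).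
split=> [n|]; first exact: (branch_opposite_quadrants (Finv w) (F1 w) (Fstep w) (hV w) n hQ).
split=> [n _|].
  rewrite (branch_natE (Finv w) (F1 w) (Fstep w)).
  by have [] := branch_inv (Finv w) (Fstep w) n.
split; last first.
  exact: (branch_lattice_basis (Finv w) (F1 w) (Fstep w)).
apply: (branch_not_badly_approximable hN (Finv w) (F1 w) (Fstep w) (hV w) (M := M)).
by move=> n; case: (hlohi n) => _ /ltW.
Qed.

End Main.

Theorem theorem1 (R : realType) (N : 'rV[R]_2 -> R) (hN : is_norm N) :
  exists M : R,
    0 < M /\
    (forall (theta delta : R) (I : nat -> set R) (m : nat) (z : int -> int),
       0 <= theta < 2 * pi -> 0 < delta ->
       (forall n, exists lo hi : R, lo < hi /\ I n = `[lo, hi]%classic) ->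
       (forall n, I n `<=` `[0, M]%classic) ->
       (0 < m)%N -> residue_sequence m z ->
       [set v : 'rV[R]_2 | ~ rational_point v /\
          exists (q : nat -> nat) (p : nat -> 'rV[int]_2),
            best_approximations N v q p /\
            (forall n, I n (N (long_displacement v q p n))) /\
            (forall n, Omega theta delta (long_displacement v q p n)) /\
            (forall n, opposite_quadrants (long_displacement v q p n)
                                          (long_displacement v q p n.+1)) /\
            (forall n : nat, (1 <= n)%N ->
               ((q n)%:Z = z n%:Z %[mod m%:Z])%Z) /\
            ~ badly_approximable N v /\
            (forall n : nat, (2 <= n)%N ->
               lattice_basis (approx_vec (q (n - 2)%N) (p (n - 2)%N))
                             (approx_vec (q (n - 1)%N) (p (n - 1)%N))
                             (approx_vec (q n) (p n)))]
       #= [set: R]) /\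
    (exists a c D : R, best_ellipsoid N a c D) /\
    (forall a c D : R, best_ellipsoid N a c D ->
       M = ((4 * a * c) / (4 * D ^+ 2 - 1)) `^ 4^-1) /\
    (N = euclidean_norm ->
       best_ellipsoid N 1 1 1 /\ M = Num.sqrt (2 / Num.sqrt 3)) /\
    (N = maximum_norm ->
       best_ellipsoid N 2^-1 2^-1 (Num.sqrt 2) /\ M = 7 `^ (- 4^-1)) /\
    (forall p : R, 2 < p -> N = p_norm p ->
       best_ellipsoid N (2 `^ (2 / p - 1)) (2 `^ (2 / p - 1))
                        (2 `^ (2^-1 - p^-1)) /\
       M = 8 `^ (2 * p)^-1 * (8 - 4 `^ p^-1) `^ (- 4^-1)) /\
    (forall p : R, 1 <= p < 2 -> N = p_norm p ->
       best_ellipsoid N 1 1 (2 `^ (p^-1 - 2^-1)) /\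
       M = Num.sqrt 2 * (2 `^ (1 + 2 / p) - 1) `^ (- 4^-1)).
Proof.
have [a [c [D hbest]]] := best_ellipsoid_exists hN.
have [hE hmax] := hbest.
exists (ellipsoid_value a c D).
(* Maximality on both sides gives all best ellipsoids the same value, so the constant can be
   computed from any of them. *)
have val a' c' D' : best_ellipsoid N a' c' D' ->
    ellipsoid_value a c D = ellipsoid_value a' c' D'.
  by move=> [hE' hmax']; apply/eqP; rewrite eq_le hmax'//= hmax.
split; first exact: (ellipsoid_value_gt0 hE).
split.
  move=> theta delta I m z _ delta0 hI hM m0 hz.
  exact: (card_admissible_vectors hN hE).
split; first by exists a, c, D.
split; first exact: val.
split.
  move=> NE; rewrite NE in hN val *.
  have best := best_ellipsoid_euclidean hN; split=> //; rewrite (val _ _ _ best).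
  apply/esym/ellipsoid_value_eq; first exact: sqrtr_ge0.
  rewrite (exprM _ 2 2) sqr_sqrtr ?divr_ge0 ?sqrtr_ge0// expr_div_n sqr_sqrtr//.
  by rewrite /ellipsoid_ratio; field.
split.
  move=> NE; rewrite NE in hN val *.
  have best := best_ellipsoid_maximum hN; split=> //; rewrite (val _ _ _ best).
  apply/esym/ellipsoid_value_eq; first exact: powR_ge0.
  by rewrite powRN4// /ellipsoid_ratio sqr_sqrtr//; field.
split.
  move=> p p2 NE; rewrite NE in hN val *.
  have best := best_ellipsoid_p_gt2 p2 hN; split=> //; rewrite (val _ _ _ best).
  exact/esym/ellipsoid_value_eq_p_gt2.
move=> p p2 NE; rewrite NE in hN val *.
have best := best_ellipsoid_p_lt2 p2 hN; split=> //; rewrite (val _ _ _ best).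
exact/esym/ellipsoid_value_eq_p_lt2.
Qed.
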